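(* Let $A$, $F$, $q$, $\phi$ satisfy conditions (a), (b), (c) of the Hypothesis in the context, and let $v\in C^0(\Lambda)$. Assume: (i) for every $\varepsilon>0$ there exist $F^\varepsilon,q^\varepsilon,\phi^\varepsilon$ (together with $A$ satisfying the Hypothesis) and $v^\varepsilon\in C^0(\Lambda)$ such that $v^\varepsilon$ is a viscosity subsolution (resp. supersolution) of the PHJB equation with generators $F^\varepsilon,q^\varepsilon,\phi^\varepsilon$; (ii) as $\varepsilon\to0$, $(F^\varepsilon,q^\varepsilon,\phi^\varepsilon,v^\varepsilon)$ converges to $(F,q,\phi,v)$ uniformly in the sense that $$\lim_{\varepsilon\to0}\ \sup_{t\in[0,T],\,\gamma_t\in\Lambda_t,\,u\in U}\ \sup_{\eta_T\in\Lambda_T}\Big[\big(|F^\varepsilon-F|+|q^\varepsilon-q|\big)(\gamma_t,u)+|\phi^\varepsilon-\phi|(\eta_T)+|v^\varepsilon-v|(\gamma_t)\Big]=0 .$$ Then $v$ is a viscosity subsolution (resp. supersolution) of the PHJB equation with generators $F,q,\phi$.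
   Context: **Path spaces.** $H$ is a real separable Hilbert space with inner product $(\cdot,\cdot)_H$ and norm $|\cdot|$; $T>0$ is fixed; $A$ generates a $C_0$-semigroup $\{e^{tA}\}_{t\ge0}$ of bounded linear operators on $H$, and $A^*$ is its adjoint. For $t\in[0,T]$, $\hat\Lambda_t=D([0,t];H)$ is the set of càdlàg functions $[0,t]\to H$ and $\Lambda_t=C([0,t];H)$. Put $\hat\Lambda^t=\bigcup_{s\in[t,T]}\hat\Lambda_s$, $\hat\Lambda=\hat\Lambda^0$, $\Lambda^t=\bigcup_{s\in[t,T]}\Lambda_s$, $\Lambda=\Lambda^0$. An element with subscript $t$, such as $\gamma_t$, is a path on $[0,t]$; $\gamma_t(s)$ is its value at $s$. For $x\in H$ and $t\le\bar t\le T$: $\gamma_t^x$ is the path on $[0,t]$ equal to $\gamma_t$ on $[0,t)$ with $\gamma_t^x(t)=\gamma_t(t)+x$; $\gamma_{t,\bar t}$ is the path on $[0,\bar t]$ equal to $\gamma_t$ on $[0,t)$ and to $\gamma_t(t)$ on $[t,\bar t]$; $\gamma_{t,\bar t,A}$ is the path on $[0,\bar t]$ equal to $\gamma_t$ on $[0,t)$ and to $e^{(s-t)A}\gamma_t(t)$ at $s\in[t,\bar t]$. Set $\|\gamma_t\|_0=\sup_{0\le s\le t}|\gamma_t(s)|$ and $d_\infty(\gamma_t,\eta_s)=|t-s|+\|\gamma_{t,T,A}-\eta_{s,T,A}\|_0$. **Derivatives.** For $f$ on paths in $\hat\Lambda$: $\partial_xf(\gamma_t)=B\in H$ if $\lim_{|h|\to0}|f(\gamma_t^h)-f(\gamma_t)-(B,h)_H|/|h|=0$;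 $\partial_tf(\gamma_t)=\lim_{l\downarrow0}\frac1l[f(\gamma_{t,t+l})-f(\gamma_t)]$ for $t<T$. $C^0(\hat\Lambda^t)$, $C^0(\Lambda^t)$ denote functionals continuous under $d_\infty$. $f\in C^1(\hat\Lambda^t)$ if $f\in C^0(\hat\Lambda^t)$ and $\partial_tf,\partial_xf$ exist and are continuous. $f\in C^1(\Lambda^t)$ if $f$ is the restriction to $\Lambda^t$ of some $\hat f\in C^1(\hat\Lambda^t)$; then $\partial_tf,\partial_xf$ on $\Lambda^t$ denote the restrictions of $\partial_t\hat f,\partial_x\hat f$. ''$A^*\partial_xf\in C^0(\Lambda^t)$'' means that $\partial_xf$ takes values in the domain of $A^*$ and $\gamma\mapsto A^*\partial_xf(\gamma)$ is $d_\infty$-continuous on $\Lambda^t$. **Hypothesis.** $(U,d)$ is a metric space; $F:\Lambda\times U\to H$, $q:\Lambda\times U\to\mathbb R$, $\phi:\Lambda_T\to\mathbb R$. (a) $\{e^{tA}\}$ is a $C_0$ contraction semigroup. (b) For every $\gamma_t\in\Lambda$, $F(\gamma_t,\cdot)$ and $q(\gamma_t,\cdot)$ are continuous in $u$. (c) There is $L>0$ such that for all $\gamma_t,\eta_s\in\Lambda$, $\zeta_T,\zeta_T'\in\Lambda_T$, $u\in U$: $|F(\gamma_t,u)|^2\le L^2(1+\|\gamma_t\|_0^2)$, $|F(\gamma_t,u)-F(\eta_s,u)|\le Ld_\infty(\gamma_t,\eta_s)$, $|q(\gamma_t,u)-q(\eta_s,u)|\le Ld_\infty(\gamma_t,\eta_s)$,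 $|q(\gamma_t,u)|\le L(1+\|\gamma_t\|_0)$, $|\phi(\zeta_T)-\phi(\zeta'_T)|\le L\|\zeta_T-\zeta_T'\|_0$, $|\phi(\zeta_T)|\le L(1+\|\zeta_T\|_0)$. **PHJB equation with generators $F,q,\phi$.** With $\mathbf H(\gamma_t,p)=\inf_{u\in U}[(p,F(\gamma_t,u))_H+q(\gamma_t,u)]$, $(\gamma_t,p)\in\Lambda\times H$, it is $$\partial_tV(\gamma_t)+(A^*\partial_xV(\gamma_t),\gamma_t(t))_H+\mathbf{H}(\gamma_t,\partial_xV(\gamma_t))=0\ \ (t\in[0,T),\ \gamma_t\in\Lambda_t),\qquad V(\gamma_T)=\phi(\gamma_T)\ \ (\gamma_T\in\Lambda_T).$$ For generators $F^\varepsilon,q^\varepsilon,\phi^\varepsilon$, replace $F,q,\phi$ by these (with the same $A$ and $U$). **Test functionals.** $S(\gamma_t)=(\|\gamma_t\|_0^2-|\gamma_t(t)|^2)^2/\|\gamma_t\|_0^2$ if $\|\gamma_t\|_0\ne0$ and $S(\gamma_t)=0$ otherwise; $\Upsilon^2(\gamma_t)=S(\gamma_t)+2|\gamma_t(t)|^2$ (the superscript $2$ is an index; $\partial_x\Upsilon^2$ is computed on $\hat\Lambda$ with the same formula). $\Phi=\{\varphi\in C^1(\Lambda): A^*\partial_x\varphi\in C^0(\Lambda)\}$. $\mathcal G_t$ is the set of $g\in C^0(\Lambda^t)$ for which there are $h\in C^1([0,T]\times\mathbb R)$ with $\nabla_xh\ge0$ (derivative in the second variable), $N>0$, $\delta_i>0$,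 $t_i\le t$, $\gamma^i_{t_i}\in\Lambda_{t_i}$ ($i=0,1,2,\dots$) with $\|\gamma^i_{t_i}\|_0\le N$, $\sum_i\delta_i\le N$, such that for all $\gamma_s\in\Lambda^t$ $$g(\gamma_s)=h(s,\Upsilon^2(\gamma_s))+\sum_{i=0}^\infty\delta_i\big[\Upsilon^2(\gamma_s-\gamma^i_{t_i,s,A})+|s-t_i|^2\big].$$ For such $g$ (with this representation) one writes $\partial_tg(\gamma_s):=h_t(s,\Upsilon^2(\gamma_s))+2\sum_i\delta_i(s-t_i)$ and $\partial_xg(\gamma_s):=\nabla_xh(s,\Upsilon^2(\gamma_s))\partial_x\Upsilon^2(\gamma_s)+\sum_i\delta_i\partial_x\Upsilon^2(\gamma_s-\gamma^i_{t_i,s,A})$. **Viscosity solutions.** $w\in C^0(\Lambda)$ is a viscosity subsolution (resp. supersolution) of the PHJB equation if $w(\gamma_T)\le\phi(\gamma_T)$ (resp. $\ge$) for all $\gamma_T\in\Lambda_T$ and, for all $t\in[0,T)$, $\varphi\in\Phi$, $g\in\mathcal G_t$ and $\gamma_t\in\Lambda_t$, whenever $0=(w-\varphi-g)(\gamma_t)=\sup_{\eta_s\in\Lambda^t}(w-\varphi-g)(\eta_s)$ (resp. $0=(w+\varphi+g)(\gamma_t)=\inf_{\eta_s\in\Lambda^t}(w+\varphi+g)(\eta_s)$), one has $$\partial_t\varphi(\gamma_t)+\partial_tg(\gamma_t)+(A^*\partial_x\varphi(\gamma_t),\gamma_t(t))_H+\mathbf H(\gamma_t,\partial_x\varphi(\gamma_t)+\partial_xg(\gamma_t))\ge0$$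 (resp. $-\partial_t\varphi(\gamma_t)-\partial_tg(\gamma_t)-(A^*\partial_x\varphi(\gamma_t),\gamma_t(t))_H+\mathbf H(\gamma_t,-\partial_x\varphi(\gamma_t)-\partial_xg(\gamma_t))\le0$). *)

(* Defs.v *)
From HB Require Import structures.
From mathcomp Require Import all_boot all_order all_algebra.
From mathcomp Require Import all_classical all_reals all_analysis.

Set Implicit Arguments.
Unset Strict Implicit.
Unset Printing Implicit Defensive.

Import Order.TTheory GRing.Theory Num.Theory.
Import numFieldNormedType.Exports.

Local Open Scope classical_set_scope.
Local Open Scope ring_scope.

(** * Hilbert spaces, semigroups, generators, adjoints *)

Section operators.
Context {R : realType} {H : completeNormedModType R}.

(* Together with the completeness of [H], this makes [(H, ip)] a real
   separable Hilbert space whose norm is the given one. *)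
Definition separable_hilbert (ip : {dot H for (@idfun R)}) : Prop :=
  (forall x : H, `|x| ^+ 2 = ip x x) /\
  (exists2 D : set H, countable D & dense D).

(* Values [E t] with [t < 0] are irrelevant. *)
Record C0_semigroup (E : R -> H -> H) : Prop := {
  semigroup_linear : forall t : R, 0 <= t -> linear (E t) ;
  semigroup_bounded : forall t : R, 0 <= t ->
    exists M : R, forall x, `|E t x| <= M * `|x| ;
  semigroup0 : forall x, E 0 x = x ;
  semigroupD : forall s t : R, 0 <= s -> 0 <= t ->
    forall x, E (s + t) x = E s (E t x) ;
  semigroup_cvg0 : forall x, E t x @[t --> 0^'+] --> x }.

(* Unbounded operators are given by their graphs: [A x y] means that [x] is in
   the domain and is sent to [y]. *)
Definition generates (A : H -> H -> Prop) (E : R -> H -> H) : Prop :=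
  C0_semigroup E /\
  forall x y, A x y <-> (t^-1 *: (E t x - x)) @[t --> 0^'+] --> y.

Definition adjoint (ip : {dot H for (@idfun R)}) (A : H -> H -> Prop) :
    H -> H -> Prop :=
  fun y z => forall x w, A x w -> ip w y = ip x z.

Definition contraction_semigroup (E : R -> H -> H) : Prop :=
  forall t x, 0 <= t -> `|E t x| <= `|x|.

End operators.

(** * Paths *)

(* A path on [0, t] is encoded as the time [t] and a function on the whole line.
   The functions are required to be constant on ]-oo, 0] and on [t, +oo[
   ([normal_path]), so that two encodings are equal exactly when they have the
   same time and agree on [0, t].  All operations below go through [mkpath],
   which restricts a function to [0, t] and extends it in this way. *)
Record hpath (R : realType) (H : completeNormedModType R) :=
  Path { ptime : R ; pval :> R -> H }.

Section paths.
Context {R : realType} {H : completeNormedModType R}.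
Local Notation path := (hpath H).

Definition clamp (t s : R) : R := Num.max 0 (Num.min s t).

Definition mkpath (t : R) (f : R -> H) : path :=
  Path t (fun s => f (clamp t s)).

Definition normal_path (g : path) : Prop :=
  forall s, g s = g (clamp (ptime g) s).

Definition cadlag (t : R) (f : R -> H) : Prop :=
  (forall s : R, 0 <= s < t -> f r @[r --> s^'+] --> f s) /\
  (forall s : R, 0 < s <= t -> cvg (f r @[r --> s^'-])).

Definition pend (g : path) : H := g (ptime g).

(* [gamma_t^x] *)
Definition pbump (g : path) (x : H) : path :=
  mkpath (ptime g) (fun s => if s < ptime g then g s else pend g + x).

(* [gamma_{t,t'}] *)
Definition pextend (g : path) (t' : R) : path :=
  mkpath t' (fun s => if s < ptime g then g s else pend g).

(* [gamma_{t,t',A}], with [E s = e^{sA}] *)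
Definition pextendA (E : R -> H -> H) (g : path) (t' : R) : path :=
  mkpath t' (fun s => if s < ptime g then g s else E (s - ptime g) (pend g)).

(* Only used for paths with the same time. *)
Definition psub (g g' : path) : path :=
  mkpath (ptime g) (fun s => g s - g' s).

Definition pnorm (g : path) : R :=
  sup [set `|g s| | s in `[0, ptime g]].

End paths.

Section path_spaces.
Context {R : realType} {H : completeNormedModType R}.
Variable T : R.
Local Notation path := (hpath H).

(* the càdlàg paths with time in [t, T] *)
Definition hLambda (t : R) : set path :=
  [set g | [/\ 0 <= ptime g, t <= ptime g <= T, normal_path g &
               cadlag (ptime g) g]].

(* the continuous paths with time in [t, T] *)
Definition Lambda (t : R) : set path :=
  [set g | [/\ 0 <= ptime g, t <= ptime g <= T, normal_path g &
               {within `[0, ptime g], continuous g}]].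

(* the continuous paths with time exactly t *)
Definition Lambda_at (t : R) : set path :=
  [set g | Lambda 0 g /\ ptime g = t].

Variable E : R -> H -> H.

Definition dinf (g g' : path) : R :=
  `|ptime g - ptime g'| + pnorm (psub (pextendA E g T) (pextendA E g' T)).

(* A functional on a set [Q] of paths is represented by a function on the type
   [hpath]; its values off [Q] are irrelevant. *)
Definition C0 {V : normedModType R} (Q : set path) (f : path -> V) : Prop :=
  forall g, Q g -> forall e : R, 0 < e ->
    exists2 d : R, 0 < d &
      forall g', Q g' -> dinf g g' < d -> `|f g' - f g| < e.

(** * Path derivatives *)

Definition dt_quot (f : path -> R) (g : path) (l : R) : R :=
  l^-1 * (f (pextend g (ptime g + l)) - f g).

Definition dt (f : path -> R) (g : path) : R := lim (dt_quot f g l @[l --> 0^'+]).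

Variable ip : {dot H for (@idfun R)}.

Definition is_dx (f : path -> R) (g : path) (B : H) : Prop :=
  (`|f (pbump g h) - f g - ip B h| / `|h|) @[h --> (0 : H)^'] --> (0 : R).

Definition dx (f : path -> R) (g : path) : H := xget 0 (is_dx f g).

(* [dt f] is only defined at paths with time [< T]. *)
Definition C1_hLambda (t : R) (f : path -> R) : Prop :=
  [/\ C0 (hLambda t) f,
      forall g, hLambda t g -> ptime g < T -> cvg (dt_quot f g l @[l --> 0^'+]),
      forall g, hLambda t g -> exists B, is_dx f g B,
      C0 [set g | hLambda t g /\ ptime g < T] (dt f) &
      C0 (hLambda t) (dx f)].

(** * Test functionals *)

Variable A : H -> H -> Prop.

(* [f] is in the class Phi, by means of an extension whose derivatives restrict
   to [ft] and [fx]; and [Afx] is the functional [A^* fx]. *)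
Definition PhiTest (f ft : path -> R) (fx Afx : path -> H) : Prop :=
  (exists fhat : path -> R,
    [/\ C1_hLambda 0 fhat,
        forall g, Lambda 0 g -> f g = fhat g,
        forall g, Lambda 0 g -> ptime g < T -> ft g = dt fhat g &
        forall g, Lambda 0 g -> fx g = dx fhat g]) /\
  (forall g, Lambda 0 g -> adjoint ip A (fx g) (Afx g)) /\
  C0 (Lambda 0) Afx.

Definition Sfun (g : path) : R :=
  if pnorm g != 0
  then (pnorm g ^+ 2 - `|pend g| ^+ 2) ^+ 2 / pnorm g ^+ 2
  else 0.

Definition Upsilon2 (g : path) : R := Sfun g + 2 * `|pend g| ^+ 2.

(* [h] is C^1 on [0, T] x R with partial derivatives [ht] and [hx]; the time
   derivative is one-sided at 0 and T. *)
Definition C1_strip (h ht hx : R -> R -> R) : Prop :=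
  [/\ forall s y : R, 0 <= s <= T ->
        ((h r y - h s y) / (r - s)) @[r --> within `[0, T] s^'] --> ht s y,
      forall s y : R, 0 <= s <= T -> is_derive y (1 : R) (h s) (hx s y),
      {within `[0, T] `*` setT, continuous (fun z : R * R => h z.1 z.2)},
      {within `[0, T] `*` setT, continuous (fun z : R * R => ht z.1 z.2)} &
      {within `[0, T] `*` setT, continuous (fun z : R * R => hx z.1 z.2)}].

Record gdata := GData {
  gh : R -> R -> R ;
  ght : R -> R -> R ;
  ghx : R -> R -> R ;
  gdelta : nat -> R ;
  gpath : nat -> path }.

(* [g] is in the class G_t, represented by the data [a] *)
Definition GTest (t : R) (g : path -> R) (a : gdata) : Prop :=
  [/\ C0 (Lambda t) g,
      C1_strip (gh a) (ght a) (ghx a),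
      forall s y : R, 0 <= s <= T -> 0 <= ghx a s y,
      exists N : R,
        [/\ 0 < N,
            forall i, 0 < gdelta a i,
            forall i, [/\ Lambda 0 (gpath a i), ptime (gpath a i) <= t &
                          pnorm (gpath a i) <= N] &
            (\sum_(0 <= i <oo) (gdelta a i)%:E <= N%:E)%E] &
      forall z, Lambda t z ->
        g z = gh a (ptime z) (Upsilon2 z) +
          limn (series (fun i => gdelta a i *
            (Upsilon2 (psub z (pextendA E (gpath a i) (ptime z)))
             + `|ptime z - ptime (gpath a i)| ^+ 2)))].

Definition g_dt (a : gdata) (z : path) : R :=
  ght a (ptime z) (Upsilon2 z) +
  2 * limn (series (fun i => gdelta a i * (ptime z - ptime (gpath a i)))).

Definition g_dx (a : gdata) (z : path) : H :=
  ghx a (ptime z) (Upsilon2 z) *: dx Upsilon2 z +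
  limn (series (fun i => gdelta a i *:
    dx Upsilon2 (psub z (pextendA E (gpath a i) (ptime z))))).

(** * The equation and its viscosity solutions *)

Context {U : metricType R}.

Record data_hypothesis (F : path -> U -> H) (q : path -> U -> R)
    (phi : path -> R) : Prop := {
  hyp_contraction : C0_semigroup E /\ contraction_semigroup E ;
  hyp_continuous : forall g, Lambda 0 g ->
    continuous (F g) /\ continuous (q g) ;
  hyp_lipschitz : exists2 L : R, 0 < L &
    (forall g g' u, Lambda 0 g -> Lambda 0 g' ->
      [/\ `|F g u| ^+ 2 <= L ^+ 2 * (1 + pnorm g ^+ 2),
          `|F g u - F g' u| <= L * dinf g g',
          `|q g u - q g' u| <= L * dinf g g' &
          `|q g u| <= L * (1 + pnorm g)]) /\
    (forall z z', Lambda_at T z -> Lambda_at T z' ->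
      `|phi z - phi z'| <= L * pnorm (psub z z') /\
      `|phi z| <= L * (1 + pnorm z)) }.

Definition Hamiltonian (F : path -> U -> H) (q : path -> U -> R)
    (g : path) (p : H) : \bar R :=
  ereal_inf (range (fun u : U => (ip p (F g u) + q g u)%:E)).

Definition viscosity_subsolution (F : path -> U -> H) (q : path -> U -> R)
    (phi w : path -> R) : Prop :=
  [/\ C0 (Lambda 0) w,
      forall z, Lambda_at T z -> w z <= phi z &
      forall t : R, 0 <= t < T ->
      forall f ft fx Afx, PhiTest f ft fx Afx ->
      forall g a, GTest t g a ->
      forall z, Lambda_at t z ->
        w z - f z - g z = 0 ->
        ereal_sup [set (w y - f y - g y)%:E | y in Lambda t] = 0%E ->
        (0 <= (ft z + g_dt a z + ip (Afx z) (pend z))%:E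
              + Hamiltonian F q z (fx z + g_dx a z)%R)%E].

Definition viscosity_supersolution (F : path -> U -> H) (q : path -> U -> R)
    (phi w : path -> R) : Prop :=
  [/\ C0 (Lambda 0) w,
      forall z, Lambda_at T z -> phi z <= w z &
      forall t : R, 0 <= t < T ->
      forall f ft fx Afx, PhiTest f ft fx Afx ->
      forall g a, GTest t g a ->
      forall z, Lambda_at t z ->
        w z + f z + g z = 0 ->
        ereal_inf [set (w y + f y + g y)%:E | y in Lambda t] = 0%E ->
        ((- ft z - g_dt a z - ip (Afx z) (pend z))%:E
         + Hamiltonian F q z (- fx z - g_dx a z)%R <= 0)%E].

End path_spaces.

(* Main.v *)
Require Import Defs.
From mathcomp Require Import all_boot all_order all_algebra.
From mathcomp Require Import all_classical all_reals all_analysis.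
From mathcomp Require Import lra ring.

Set Implicit Arguments.
Unset Strict Implicit.
Unset Printing Implicit Defensive.

Import Order.TTheory GRing.Theory Num.Theory.
Import numFieldNormedType.Exports.

Local Open Scope classical_set_scope.
Local Open Scope ring_scope.

(** The stability theorem follows the usual scheme: a maximum point of the limit
problem is perturbed into a maximum point of the approximate problem, the
inequality known there is written down, and the approximation is removed.

Let [z] maximise [v - f - g] over the paths later than [z]. If [v'] is uniformly
close to [v], then [z] almost maximises [v' - f - g]. Path space is not locally
compact, so a nearby true maximum has to be forced by a variational principle
([borwein_preiss], [path_variational]): from [z] one builds a sequence of paths
[xs i], increasing in time, and a limit path [x] which maximises [v' - f - g]
minus the series of the penalties [2^-i gauge _ (xs i)] over the paths later
than [x]. The gauge [Upsilon2 (y - xs i) + |t - t_i|^2] is precisely the one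
allowed in the series of a test functional, so the penalties only lengthen that
series: the perturbed functional is again a test functional, now attached to the
time of [x] ([GTest_perturb]).

Three facts make this work. The functional [Upsilon2] is equivalent to the
squared supremum norm ([Upsilon2_bounds]), so that the gauge controls [d_infinity],
for which path space is complete ([Lambda_complete]); prolonging paths by a
contraction semigroup does not increase their distance ([pnorm_gap]), which is
why paths with different times can be compared. It is vertically differentiable,
with a derivative of norm at most four times the norm of the path
([is_dx_Upsilon2], [dx_Upsilon2_le]); as all gauges at [x] are small, the
penalties change the derivatives of the test functional by little
([g_dt_perturb], [g_dx_perturb]). Finally those derivatives are continuous along
paths in the domain of the test functional, by dominated passage to the limit in
the series ([cvg_weighted], [cvg_g_dt], [cvg_g_dx]); hence the data of the
equation at [x] and at [z] are close ([perturbed_test]). The Hamiltonian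
integrands being close uniformly in the control ([Hamiltonian_close]), both
viscosity inequalities pass to the limit. The supersolution case is obtained by
maximising [- v - f - g]. *)

(** * Limits by comparison *)

Section squeeze.
Context {R : realType} {V : normedModType R} {X : Type} {F : set_system X}
  {FF : Filter F}.

Lemma cvg_dist_squeeze (f : X -> V) (l : V) (g : X -> R) :
  (\forall x \near F, `|l - f x| <= g x) -> g x @[x --> F] --> (0 : R) ->
  f x @[x --> F] --> l.
Proof.
move=> fg g0; apply/cvgrPdist_le => e e0.
apply: filterS2 fg (cvgr0_norm_le _ g0 _ e0) => x fgx ge.
exact: (le_trans fgx (le_trans (ler_norm _) ge)).
Qed.

Lemma cvg_dist0 (f : X -> V) (l : V) :
  f x @[x --> F] --> l -> `|l - f x| @[x --> F] --> (0 : R).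
Proof.
move=> fl; rewrite -(normr0 V) -(subrr l); apply: cvg_norm; apply: cvgB => //.
exact: cvg_cst.
Qed.

Lemma cvgXn (f : X -> R) (l : R) n :
  f x @[x --> F] --> l -> f x ^+ n @[x --> F] --> l ^+ n.
Proof.
move=> fl; elim: n => [|n ih].
  by under eq_fun do rewrite expr0; rewrite expr0; exact: cvg_cst.
by under eq_fun do rewrite exprS; rewrite exprS; exact: cvgM.
Qed.

End squeeze.
Arguments cvgXn {R X F FF f l n}.

(** * Inner products and contraction semigroups *)

Section inner_product.
Context {R : realType} {H : completeNormedModType R}.
Variable ip : {dot H for (@idfun R)}.
Hypothesis ip_norm : forall x : H, `|x| ^+ 2 = ip x x.

Lemma ip_sym x y : ip x y = ip y x.
Proof. by rewrite hermC expr0 mul1r. Qed.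

Lemma ipDl x y z : ip (x + y) z = ip x z + ip y z.
Proof. exact: linearDl. Qed.

Lemma ipZl a x z : ip (a *: x) z = a * ip x z.
Proof. exact: linearZl_LR. Qed.

Lemma ipBl x y z : ip (x - y) z = ip x z - ip y z.
Proof. exact: linearBl. Qed.

Lemma ipBr x y z : ip z (x - y) = ip z x - ip z y.
Proof. by rewrite ip_sym ipBl !(ip_sym _ z). Qed.

Lemma normD_sqr x y : `|x + y| ^+ 2 = `|x| ^+ 2 + 2 * ip x y + `|y| ^+ 2.
Proof.
by rewrite !ip_norm ipDl (ip_sym x) (ip_sym y) !ipDl (ip_sym y x); ring.
Qed.

(** The squared norm of [|y|^2 x - (x, y) y] is nonnegative. *)
Lemma normr_ip_le x y : `|ip x y| <= `|x| * `|y|.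
Proof.
have [->|y0] := eqVneq y 0; first by rewrite linear0 !normr0 mulr0.
have yp : 0 < `|y| ^+ 2 by rewrite exprn_gt0// normr_gt0.
have : 0 <= `|(`|y| ^+ 2 *: x) + (- ip x y) *: y| ^+ 2 by rewrite sqr_ge0.
rewrite normD_sqr !normrZ ipZl (ip_sym x (_ *: _)) ipZl (ip_sym y) normrN.
rewrite !exprMn normr_id -(normrX 2 (ip x y)) (ger0_norm (sqr_ge0 (ip x y))).
move=> h; have {h} : 0 <= `|y| ^+ 2 * ((`|x| * `|y|) ^+ 2 - (ip x y) ^+ 2).
  by apply: (le_trans h); rewrite le_eqVlt; apply/orP; left; apply/eqP; ring.
rewrite pmulr_rge0// subr_ge0 => cab.
rewrite -(@ler_pXn2r _ 2)// ?nnegrE ?mulr_ge0//.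
by rewrite -normrX ger0_norm ?sqr_ge0//.
Qed.

Lemma cvg_ip {X : Type} {F : set_system X} {FF : Filter F}
    (f g : X -> H) (x y : H) :
  f z @[z --> F] --> x -> g z @[z --> F] --> y ->
  ip (f z) (g z) @[z --> F] --> ip x y.
Proof.
move=> fx gy; apply: (@cvg_dist_squeeze _ _ _ _ _ _ _
  (fun z => `|x - f z| * `|y| + `|f z| * `|y - g z|)).
  apply: nearW => z.
  have -> : ip x y - ip (f z) (g z) = ip (x - f z) y + ip (f z) (y - g z).
    by rewrite ipBl ipBr; ring.
  by rewrite (le_trans (ler_normD _ _))// lerD// normr_ip_le.
rewrite -(addr0 0) -[X in X + _](mul0r `|y|) -[X in _ + X](mulr0 `|x|).
apply: cvgD; apply: cvgM.
- exact: cvg_dist0.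
- exact: cvg_cst.
- exact: cvg_norm.
- exact: cvg_dist0.
Qed.

End inner_product.

Section semigroup.
Context {R : realType} {H : completeNormedModType R}.
Variable E : R -> H -> H.
Hypotheses (sgE : C0_semigroup E) (cE : contraction_semigroup E).

Lemma semigroupB t x y : 0 <= t -> E t (x - y) = E t x - E t y.
Proof.
move=> t0; have := semigroup_linear sgE t0 (-1) y x.
by rewrite !scaleN1r ![- _ + _]addrC.
Qed.

Lemma semigroup0r t : 0 <= t -> E t 0 = 0.
Proof. by move=> t0; rewrite -{1}(subrr 0) semigroupB// subrr. Qed.

Lemma semigroup_dist_le s t x : 0 <= s -> 0 <= t ->
  `|E t x - E s x| <= `|E `|t - s| x - x|.
Proof.
wlog st : s t / s <= t => [hw|] s0 t0.
  have [/hw|/ltW ts] := leP s t; first exact.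
  by rewrite distrC (distrC t); exact: hw.
rewrite ger0_norm ?subr_ge0//.
rewrite -[X in `|E X x - _| <= _](subrKC s t) semigroupD ?subr_ge0//.
rewrite -semigroupB//; exact: cE.
Qed.

Lemma cvg_semigroup0 {X : Type} {F : set_system X} {FF : Filter F}
    (f : X -> R) (x : H) :
  (forall z, 0 <= f z) -> f z @[z --> F] --> 0 -> E (f z) x @[z --> F] --> x.
Proof.
move=> f0 fc; apply/cvgrPdist_lt => e e0.
have /cvgrPdist_lt/(_ _ e0) := @semigroup_cvg0 _ _ _ sgE x.
rewrite near_withinE => /fc h0; near=> z.
have h : 0 < f z -> `|x - E (f z) x| < e by near: z; exact: h0.
have := f0 z; rewrite le_eqVlt => /orP[/eqP <-|/h//].
by rewrite (semigroup0 sgE) subrr normr0.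
Unshelve. all: by end_near.
Qed.

(** Contractivity turns strong continuity at the time 0 into joint continuity
in time and space. *)
Lemma cvg_semigroup {X : Type} {F : set_system X} {FF : Filter F}
    (f : X -> R) (g : X -> H) (t : R) (x : H) :
  (forall z, 0 <= f z) -> 0 <= t ->
  f z @[z --> F] --> t -> g z @[z --> F] --> x ->
  E (f z) (g z) @[z --> F] --> E t x.
Proof.
move=> f0 t0 ft gx; apply: (@cvg_dist_squeeze _ _ _ _ _ _ _
  (fun z => `|x - g z| + `|E `|t - f z| x - x|)).
  apply: nearW => z.
  have -> : E t x - E (f z) (g z) = E (f z) (x - g z) + (E t x - E (f z) x).
    by rewrite semigroupB// [RHS]addrC subrKA.
  rewrite (le_trans (ler_normD _ _))// lerD ?cE//.
  exact: semigroup_dist_le.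
rewrite -(addr0 0); apply: cvgD; first exact: cvg_dist0.
under eq_fun do rewrite distrC.
by apply: cvg_dist0; apply: cvg_semigroup0 => //; exact: cvg_dist0.
Qed.

End semigroup.

(** * Continuous paths *)

Section paths.
Context {R : realType} {H : completeNormedModType R}.
Local Notation path := (hpath H).
Implicit Types (z y : path) (t s : R).

Lemma clamp_itv t s : 0 <= t -> 0 <= clamp t s <= t.
Proof. by move=> t0; rewrite /clamp le_max lexx ge_max t0 ge_min lexx orbT. Qed.

Lemma clamp_id t s : 0 <= s <= t -> clamp t s = s.
Proof. by move=> /andP[s0 st]; rewrite /clamp (min_idPl st) (max_idPr s0). Qed.

Lemma clamp_clamp t t' s : 0 <= t <= t' -> clamp t (clamp t' s) = clamp t s.
Proof.
move=> /andP[t0 tt]; rewrite /clamp /Num.max /Num.min.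
by repeat case: ifPn => //; rewrite -?leNgt => *; lra.
Qed.

Lemma clamp_dist_le t s s' : `|clamp t s - clamp t s'| <= `|s - s'|.
Proof.
have := ler_norm (s - s'); have := ler_norm (s' - s); rewrite distrC.
rewrite /clamp /Num.max /Num.min ler_norml => *; apply/andP; split;
by repeat case: ifPn; rewrite -?leNgt => *; lra.
Qed.
End paths.

Section continuous_paths.
Context {R : realType} {H : completeNormedModType R}.
Local Notation path := (hpath H).
Implicit Types (z y : path) (t s : R).

(** Extending by constants turns a continuous path on [[0, t]] into a function
continuous on the whole line, so that continuity within an interval need not
be carried around. *)
Definition cpath z : Prop :=
  [/\ 0 <= ptime z, normal_path z & continuous (pval z)].

Lemma clamp_continuous t : continuous (clamp t : R -> R).
Proof.
move=> s; apply: (@cvg_dist_squeeze _ _ _ _ _ _ _ (fun r => `|s - r|)).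
  by apply: nearW => r; exact: clamp_dist_le.
exact: cvg_dist0.
Qed.

Lemma LambdaP T t z : Lambda T t z <-> cpath z /\ t <= ptime z <= T.
Proof.
split=> [[z0 zT nz cz]|[[z0 nz cz] zT]]; last first.
  by split => //; exact: continuous_subspaceT.
split=> //; split=> // s.
have -> : pval z = pval z \o clamp (ptime z).
  by apply/funext => r /=; exact: nz.
have /subspace_continuousP/(_ (clamp (ptime z) s)) := cz.
rewrite /= in_itv /= clamp_itv// => /(_ isT) h.
apply: (cvg_comp _ _ _ h).
move=> P; rewrite /within /= => nP; near=> r.
have h0 : [set` `[0, ptime z]] (clamp (ptime z) r) -> P (clamp (ptime z) r).
  by near: r; exact: (clamp_continuous nP).
by apply: h0; rewrite /= in_itv /= clamp_itv.
Unshelve. all: by end_near. Qed.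

Lemma Lambda_cpath T t z : Lambda T t z -> cpath z.
Proof. by move=> /LambdaP[]. Qed.

Lemma Lambda_le T t t' z : t <= t' -> Lambda T t' z -> Lambda T t z.
Proof.
move=> tt /LambdaP[cz /andP[tz zT]]; apply/LambdaP; split=> //.
by rewrite zT (le_trans tt tz).
Qed.

Lemma pnorm_ub z s : cpath z -> `|z s| <= pnorm z.
Proof.
move=> [z0 nz cz].
have [|c _ cmax] := @EVT_max R (fun s => `|z s|) 0 (ptime z) z0.
  by apply: continuous_subspaceT => r; apply: cvg_norm; exact: cz.
rewrite nz; apply: ub_le_sup.
  by exists `|z c| => _ [r rI <-]; apply: cmax; rewrite inE in rI *.
by exists (clamp (ptime z) s) => //=; rewrite in_itv /= clamp_itv.
Qed.

Lemma pnorm_le z c : 0 <= ptime z ->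
  (forall s, 0 <= s <= ptime z -> `|z s| <= c) -> pnorm z <= c.
Proof.
move=> z0 zc; apply: ge_sup.
  by exists `|z 0|, 0 => //=; rewrite in_itv /= lexx.
by move=> _ [r /= rI <-]; apply: zc; rewrite in_itv /= in rI.
Qed.

Lemma pnorm_ge0 z : cpath z -> 0 <= pnorm z.
Proof. by move=> cz; apply: le_trans (pnorm_ub 0 cz). Qed.

Lemma pnorm_pend z : cpath z -> `|pend z| <= pnorm z.
Proof. exact: pnorm_ub. Qed.

Lemma cpath_mkpath t (f : R -> H) : 0 <= t -> continuous f ->
  cpath (mkpath t f).
Proof.
move=> t0 cf; split=> //; first by move=> s /=; rewrite clamp_clamp// t0 lexx.
move=> s; apply: continuous_comp; [exact: clamp_continuous|exact: cf].
Qed.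

Lemma cpath_psub z y : cpath z -> cpath y -> cpath (psub z y).
Proof.
move=> [z0 _ cz] [_ _ cy]; apply: cpath_mkpath => // s.
by apply: cvgB; [exact: cz|exact: cy].
Qed.

Lemma psubE z y s : cpath z -> psub z y s = z s - y (clamp (ptime z) s).
Proof. by case=> _ nz _; rewrite /psub /= -nz. Qed.

Lemma pnorm_psubC z y : cpath z -> cpath y -> ptime z = ptime y ->
  pnorm (psub z y) = pnorm (psub y z).
Proof.
move=> cz cy e; congr sup; apply/seteqP; split => _ [s /= sI <-];
  exists s => //=; rewrite ?e// -?e//; exact: distrC.
Qed.

Lemma pnorm_psub_triangle z y x : cpath z -> cpath y -> cpath x ->
  ptime z = ptime y -> ptime y = ptime x ->
  pnorm (psub z x) <= pnorm (psub z y) + pnorm (psub y x).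
Proof.
move=> cz cy cx zy yx; apply: pnorm_le; first by case: cz.
move=> s sI; rewrite /= -(subrKA (y (clamp (ptime z) s))).
rewrite (le_trans (ler_normD _ _))//.
apply: lerD; first exact: (pnorm_ub s (cpath_psub cz cy)).
have := pnorm_ub s (cpath_psub cy cx); by rewrite /= zy.
Qed.

End continuous_paths.

Section prolongation.
Context {R : realType} {H : completeNormedModType R}.
Local Notation path := (hpath H).
Implicit Types (z y : path) (t s : R).
Variables (T : R) (E : R -> H -> H).
Hypotheses (T0 : 0 <= T) (sgE : C0_semigroup E) (cE : contraction_semigroup E).

Local Notation ext z := (pextendA E z T).

(** Before the time of [z] the semigroup acts at the time 0, hence trivially; the
prolongation is thus given by one formula, whose continuity is that of the
semigroup. *)
Lemma pextendAE z t s : cpath z ->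
  pextendA E z t s = E (Num.max 0 (clamp t s - ptime z)) (z (clamp t s)).
Proof.
move=> [z0 nz _]; rewrite /pextendA /=; set r := clamp t s.
case: ltP => rz; first by rewrite max_l ?(semigroup0 sgE)// subr_le0 ltW.
rewrite max_r ?subr_ge0//; congr (E _ _); rewrite /pend [RHS]nz.
by rewrite /clamp (min_idPr rz) max_r.
Qed.

Lemma cpath_pextendA z t : 0 <= t -> cpath z -> cpath (pextendA E z t).
Proof.
move=> t0 cz; have [z0 nz cpz] := cz.
pose f s := E (Num.max 0 (s - ptime z)) (z s).
have -> : pextendA E z t = mkpath t f.
  by congr Path; apply/funext => s; have := pextendAE t s cz.
apply: cpath_mkpath => // s; apply: cvg_semigroup => //.
- by move=> r; rewrite le_max lexx.
- by rewrite le_max lexx.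
- apply: (@cvg_dist_squeeze _ _ _ _ _ _ _ (fun r => `|s - r|)).
    apply: nearW => r; have := ler_norm (s - r); have := ler_norm (r - s).
    rewrite distrC /Num.max ler_norml => *; apply/andP; split;
    by repeat case: ifPn; rewrite -?leNgt => *; lra.
  exact: cvg_dist0.
- exact: cpz.
Qed.

Lemma pextendA_ext z t s : 0 <= t <= T ->
  pextendA E z t s = ext z (clamp t s).
Proof.
move=> /andP[t0 tT]; rewrite /pextendA /= [clamp T (clamp t s)]clamp_id//.
by have /andP[-> /le_trans->] := clamp_itv s t0.
Qed.

Lemma ext_id z s : cpath z -> ptime z <= T -> 0 <= s <= ptime z ->
  ext z s = z s.
Proof.
move=> cz zT /andP[s0 sz]; rewrite pextendAE// clamp_id ?s0 ?(le_trans sz)//.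
by rewrite max_l ?(semigroup0 sgE)// subr_le0.
Qed.

(** Past its own time, a prolonged path follows the semigroup. *)
Lemma ext_flow z t s : cpath z -> ptime z <= t -> t <= s <= T ->
  ext z s = E (s - t) (ext z t).
Proof.
move=> cz zt /andP[ts sT]; have [z0 nz _] := cz.
have t0 := le_trans z0 zt; have s0 := le_trans t0 ts.
rewrite !pextendAE// !clamp_id ?t0 ?s0//= ?(le_trans ts)//.
rewrite !max_r ?subr_ge0 ?(le_trans zt)// -semigroupD ?subr_ge0//.
rewrite subrKA; congr (E _ _); rewrite nz [in RHS]nz /clamp.
by rewrite !min_r// (le_trans zt).
Qed.

(** The argument [gamma_s - gamma^i_{t_i,s,A}] of the test functionals. *)
Definition gap z y : path := psub z (pextendA E y (ptime z)).

Lemma gapE z y s : cpath z -> ptime z <= T ->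
  gap z y s = ext z (clamp (ptime z) s) - ext y (clamp (ptime z) s).
Proof.
move=> cz zT; have z0 : 0 <= ptime z by case: cz.
rewrite /gap psubE// pextendA_ext ?z0// clamp_clamp ?z0 ?lexx//.
by rewrite (@ext_id z) ?clamp_itv//; case: cz => _ <-.
Qed.

Lemma cpath_gap z y : cpath z -> cpath y -> cpath (gap z y).
Proof.
by move=> cz cy; apply: cpath_psub => //; apply: cpath_pextendA => //; case: cz.
Qed.

(** As [E] is a contraction semigroup, prolonging both paths does not increase
their distance. *)
Lemma pnorm_gap z y : cpath z -> cpath y -> ptime y <= ptime z <= T ->
  pnorm (gap z y) = pnorm (psub (ext z) (ext y)).
Proof.
move=> cz cy /andP[yz zT]; have z0 : 0 <= ptime z by case: cz.
have cez := cpath_pextendA T0 cz; have cey := cpath_pextendA T0 cy.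
have cg := cpath_gap cz cy.
apply/eqP; rewrite eq_le; apply/andP; split.
  apply: pnorm_le => // s sI; rewrite gapE// clamp_id//.
  have := pnorm_ub s (cpath_psub cez cey); rewrite psubE// [clamp _ s]clamp_id//.
  by case/andP: sI => -> /le_trans; exact.
apply: pnorm_le => // s /andP[s0 sT]; rewrite psubE// [clamp _ s]clamp_id ?s0//.
have [sz|/ltW zs] := leP s (ptime z).
  by have := pnorm_ub s cg; rewrite gapE// clamp_id ?s0.
rewrite (@ext_flow z (ptime z) s) ?zs// (@ext_flow y (ptime z) s) ?zs//.
rewrite -semigroupB ?subr_ge0//.
rewrite (le_trans (cE _ _)) ?subr_ge0//.
by have := pnorm_ub (ptime z) cg; rewrite gapE// clamp_id ?z0 /=.
Qed.

Lemma dinf_gap z y : cpath z -> cpath y -> ptime y <= ptime z <= T ->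
  dinf T E z y = `|ptime z - ptime y| + pnorm (gap z y).
Proof. by move=> cz cy yz; rewrite /dinf pnorm_gap. Qed.

Lemma pend_gap z y : cpath z -> ptime z <= T ->
  pend (gap z y) = pend z - ext y (ptime z).
Proof.
move=> cz zT; have z0 : 0 <= ptime z by case: cz.
rewrite /pend gapE// -[ptime (gap z y)]/(ptime z) clamp_id ?z0 ?lexx//.
by rewrite (@ext_id z)// z0 lexx.
Qed.

(** The prolongation of the null path vanishes, so that every statement about
[gap z y] specialises to one about [z]. *)
Definition null_path : path := Path 0 (fun=> 0).

Lemma cpath_null : cpath null_path.
Proof. by split => // s; exact: cvg_cst. Qed.

Lemma gap_null z : cpath z -> gap z null_path = z.
Proof.
move=> cz; have [z0 nz _] := cz; have c0 := cpath_null.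
have e s : gap z null_path s = z s.
  rewrite /gap psubE// pextendAE//= semigroup0r ?subr0// ?le_max ?lexx//.
have {}e : pval (gap z null_path) = pval z by apply/funext.
have : ptime (gap z null_path) = ptime z by [].
by case: (gap z null_path) e => t f /= ->; case: z {nz cz z0} => ? ? /= ->.
Qed.

End prolongation.

(** * The functional Upsilon2 and its vertical derivative *)

Section upsilon.
Context {R : realType} {H : completeNormedModType R}.
Local Notation path := (hpath H).
Implicit Types (z y : path).

(** The form in which [Upsilon2] is a smooth function of the two norms away from
the null path; it remains true there because a quotient by 0 is 0. *)
Lemma Upsilon2E z : `|pend z| <= pnorm z ->
  Upsilon2 z = pnorm z ^+ 2 + `|pend z| ^+ 4 / pnorm z ^+ 2.
Proof.
move=> am; rewrite /Upsilon2 /Sfun; case: ifPn => [m0|/negPn/eqP m0].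
  by field.
move: am; rewrite m0 normr_le0 => /eqP ->.
by rewrite normr0 !expr0n /= mulr0 mul0r.
Qed.

Lemma Upsilon2_bounds z : cpath z ->
  pnorm z ^+ 2 <= Upsilon2 z <= 2 * pnorm z ^+ 2.
Proof.
move=> cz; have am := pnorm_pend cz; rewrite Upsilon2E//.
have [m0|m0] := eqVneq (pnorm z) 0.
  by rewrite m0 expr0n /= invr0 !mulr0 addr0 lexx.
have mp : 0 < pnorm z by rewrite lt_def m0 pnorm_ge0.
have a4 : `|pend z| ^+ 4 / pnorm z ^+ 2 <= pnorm z ^+ 2.
  rewrite ler_pdivrMr ?exprn_gt0// -exprD.
  by apply: lerXn2r; rewrite // nnegrE // ltW.
have a40 : 0 <= `|pend z| ^+ 4 / pnorm z ^+ 2.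
  by rewrite divr_ge0// exprn_ge0// ltW.
by apply/andP; split; lra.
Qed.

Lemma Upsilon2_ge0 z : cpath z -> 0 <= Upsilon2 z.
Proof.
by move=> /Upsilon2_bounds/andP[+ _]; apply: le_trans; exact: sqr_ge0.
Qed.

Lemma pend_bump z h : 0 <= ptime z -> pend (pbump z h) = pend z + h.
Proof. by move=> z0; rewrite /pend /= clamp_id ?z0 ?lexx// ltxx. Qed.

(** Bumping the end point of a continuous path changes its norm as if the end
point were added to the path: the values before the end still have supremum
[pnorm z], except on the degenerate interval [[0, 0]]. *)
Lemma pnorm_bump z h : cpath z ->
  pnorm (pbump z h) =
  if 0 < ptime z then Num.max (pnorm z) `|pend z + h| else `|pend z + h|.
Proof.
move=> cz; have [z0 nz cpz] := cz; set t := ptime z.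
have Me s : 0 <= s <= t ->
    pbump z h s = if s < t then z s else pend z + h.
  by move=> sI; rewrite /= clamp_id.
have Mle : pnorm (pbump z h) <= Num.max (pnorm z) `|pend z + h|.
  apply: pnorm_le => // s /Me ->; case: ifPn => _; rewrite le_max.
    by rewrite pnorm_ub.
  by rewrite lexx orbT.
have Mub s : 0 <= s <= t -> `|pbump z h s| <= pnorm (pbump z h).
  move=> sI; apply: ub_le_sup; last by exists s => //=; rewrite in_itv.
  exists (Num.max (pnorm z) `|pend z + h|) => _ [r rI <-].
  rewrite Me; last by rewrite /= in_itv in rI.
  by case: ifPn => _; rewrite le_max ?pnorm_ub// lexx orbT.
have Mb : `|pend z + h| <= pnorm (pbump z h).
  by have := Mub t; rewrite Me z0 lexx// ltxx; exact.
case: ifPn => t0.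
  apply/eqP; rewrite eq_le Mle/= ge_max Mb andbT.
  have Mlt s : 0 <= s < t -> `|z s| <= pnorm (pbump z h).
    by move=> /andP[s0 st]; have := Mub s; rewrite Me s0 ltW// st; exact.
  apply: pnorm_le => // s /andP[s0]; rewrite le_eqVlt => /orP[/eqP ->|st].
    (* the value at the end point is a limit from the left *)
    have zl : z r @[r --> t^'-] --> z t by apply: cvg_at_left_filter; exact: cpz.
    apply: (ler_cvg_to (cvg_norm zl) (cvg_cst (pnorm (pbump z h)))).
    near=> r; apply: Mlt; apply/andP; split; last by near: r; exact: nbhs_left_lt.
    by apply: ltW; near: r; exact: nbhs_left_gt.
  by apply: Mlt; rewrite s0.
apply/eqP; rewrite eq_le Mb andbT.
have t0' : t = 0 by apply/eqP; rewrite eq_le z0 andbT leNgt.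
apply: pnorm_le => // s sI; rewrite Me// ifN//.
by rewrite -leNgt t0'; case/andP: sI.
Unshelve. all: by end_near. Qed.

Section dx_upsilon.
Variable ip : {dot H for (@idfun R)}.
Hypothesis ip_norm : forall x : H, `|x| ^+ 2 = ip x x.

(** Two candidates are compared along the direction of their difference. *)
Lemma is_dx_unique (f : path -> R) z (B B' : H) :
  is_dx ip f z B -> is_dx ip f z B' -> B = B'.
Proof.
move=> fB fB'; apply/eqP; rewrite -subr_eq0; apply/negPn/negP => D0.
set D := B - B' in D0; have Dp : 0 < `|D| by rewrite normr_gt0.
have := cvgD fB fB'; rewrite addr0 => /(_ (dnbhs_filter _)) q0.
(* both quotients are small at small positive multiples of [D] *)
have rD : (r *: D) @[r --> (0 : R)^'+] --> (0 : H)^'.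
  move=> P nP; suff : \forall r \near (0 : R)^'+, P (r *: D) by [].
  have c : (r *: D) @[r --> (0 : R)^'+] --> (0 : H).
    rewrite -(scale0r D); apply: cvgZl; apply: cvg_at_right_filter; exact: cvg_id.
  near=> r.
  have h : r *: D != 0 -> P (r *: D) by near: r; exact: (c _ nP).
  by apply: h; rewrite scaler_eq0 negb_or D0 andbT gt_eqF.
have := cvgr0_norm_lt _ (cvg_comp _ _ rD q0) _ Dp => /= n0.
have [r [r0 rd]] : exists r : R, 0 < r /\
  `| `|f (pbump z (r *: D)) - f z - ip B (r *: D)| / `|r *: D| +
    `|f (pbump z (r *: D)) - f z - ip B' (r *: D)| / `|r *: D| | < `|D|.
  near (0 : R)^'+ => r; exists r; split=> //; near: r; exact: n0.
have rDp : 0 < `|r *: D| by rewrite normrZ mulr_gt0// normr_gt0 gt_eqF.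
move: rd; apply/negP; rewrite -leNgt -mulrDl ger0_norm; last first.
  by rewrite divr_ge0// addr_ge0.
rewrite ler_pdivlMr//.
have -> : `|D| * `|r *: D| = `|ip D (r *: D)|.
  rewrite (ip_sym ip D) (ipZl ip) -ip_norm normrM normrZ expr2 normrM normr_id.
  by rewrite mulrCA.
have -> : ip D (r *: D) = (f (pbump z (r *: D)) - f z - ip B' (r *: D)) -
    (f (pbump z (r *: D)) - f z - ip B (r *: D)).
  rewrite /D (ipBl ip); ring.
by rewrite (le_trans (ler_normB _ _))// addrC.
Unshelve. all: by end_near. Qed.

(** The derivative comes from [|x + h|^2 = |x|^2 + 2 (x, h) + |h|^2]: with
[n = pnorm z ^+ 2], the functional is [n + x^2 / n] in terms of the squared
norm [x] of the end point, up to the correction [d], of second order, which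
arises when the bumped end point exceeds [pnorm z]. *)
Lemma Upsilon2_bump z h : cpath z -> 0 < pnorm z ->
  exists d : R, 0 <= d <= (`|pend z + h| ^+ 2 - `|pend z| ^+ 2) ^+ 2 /\
    Upsilon2 (pbump z h) =
      pnorm z ^+ 2 + (`|pend z + h| ^+ 4 - d) / pnorm z ^+ 2.
Proof.
move=> cz mp; have z0 : 0 <= ptime z by case: cz.
have am := pnorm_pend cz.
rewrite Upsilon2E pend_bump// pnorm_bump//; last first.
  by case: ifPn => // _; rewrite le_max lexx orbT.
set b := `|pend z + h|; set a := `|pend z| in am *; set m := pnorm z in mp am *.
have b0 : 0 <= b by exact: normr_ge0. have a0 : 0 <= a by exact: normr_ge0.
have [->|[e mb]] : (if 0 < ptime z then Num.max m b else b) = m \/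
    (if 0 < ptime z then Num.max m b else b) = b /\ (m <= b \/ a = m).
- case: ifPn => t0.
    by have [bm|/ltW mb] := leP b m; [left|right; split=> //; left].
  right; split=> //; right.
  have t0' : ptime z = 0 by apply/eqP; rewrite eq_le z0 andbT leNgt.
  apply/eqP; rewrite eq_le am/=; apply: pnorm_le => // s; rewrite t0' => sI.
  have -> : s = ptime z by rewrite t0'; apply/eqP; rewrite eq_le andbC.
  by [].
- by exists 0; rewrite subr0 lexx sqr_ge0.
exists ((b ^+ 2 - m ^+ 2) ^+ 2); rewrite e sqr_ge0/=; split.
  case: mb => [mb|->//].
  have mb2 : m ^+ 2 <= b ^+ 2 by apply: lerXn2r; rewrite // nnegrE ltW.
  have am2 : a ^+ 2 <= m ^+ 2 by apply: lerXn2r; rewrite // nnegrE ltW.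
  by apply: lerXn2r; rewrite ?nnegrE ?subr_ge0 ?lerD2l ?lerN2// (le_trans am2).
have m0 : m != 0 by rewrite gt_eqF.
have [->|bn0] := eqVneq b 0; first by rewrite !expr0n /= mul0r; field.
by field; rewrite m0 bn0.
Qed.

Lemma is_dx_Upsilon2 z : cpath z ->
  is_dx ip Upsilon2 z ((4 * `|pend z| ^+ 2 / pnorm z ^+ 2) *: pend z).
Proof.
move=> cz; have am := pnorm_pend cz.
have key h : `|Upsilon2 (pbump z h) - Upsilon2 z -
    ip ((4 * `|pend z| ^+ 2 / pnorm z ^+ 2) *: pend z) h| <=
    `|h| ^+ 2 * ((2 + `|h| / pnorm z) ^+ 2 + 2).
  have z0 : 0 <= ptime z by case: cz.
  rewrite (ipZl ip) [Upsilon2 z]Upsilon2E//.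
  have [m0|m0] := eqVneq (pnorm z) 0.
    have a0 : pend z = 0 by apply/eqP; rewrite -normr_le0 -m0.
    have M : pnorm (pbump z h) = `|h|.
      by rewrite pnorm_bump// m0 a0 add0r max_r// if_same.
    rewrite Upsilon2E ?M ?pend_bump// a0 add0r//.
    rewrite m0 normr0 !expr0n /= invr0 !mulr0 mul0r !subr0 addr0 subr0.
    have [->|h0] := eqVneq h 0; first by rewrite normr0 !expr0n /= !mul0r addr0 normr0.
    have -> : `|h| ^+ 2 + `|h| ^+ 4 / `|h| ^+ 2 = `|h| ^+ 2 * 2.
      by field; rewrite normr_eq0.
    by rewrite ger0_norm ?mulr_ge0 ?sqr_ge0// ler_wpM2l ?sqr_ge0//; lra.
  have mp : 0 < pnorm z by rewrite lt_def m0 pnorm_ge0.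
  have [d [/andP[d0 dle] ->]] := Upsilon2_bump h cz mp.
  have bE := normD_sqr ip_norm (pend z) h.
  have bt := ler_normD (pend z) h; have bt' := ler_distD 0 (pend z + h) h.
  set b := `|pend z + h| in dle bE bt *; set a := `|pend z| in am dle bE bt *.
  set m := pnorm z in m0 mp am *; set k := `|h| in bE bt *.
  set c := ip (pend z) h in bE *.
  have b0 : 0 <= b by exact: normr_ge0. have a0 : 0 <= a by exact: normr_ge0. have k0 : 0 <= k by exact: normr_ge0.
  have -> : m ^+ 2 + (b ^+ 4 - d) / m ^+ 2 - (m ^+ 2 + a ^+ 4 / m ^+ 2) -
      4 * a ^+ 2 / m ^+ 2 * c =
      ((b ^+ 2 - a ^+ 2) ^+ 2 - d) / m ^+ 2 + 2 * (a ^+ 2 / m ^+ 2) * k ^+ 2.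
    by rewrite (_ : c = (b ^+ 2 - a ^+ 2 - k ^+ 2) / 2); [field|lra].
  have am2 : a ^+ 2 / m ^+ 2 <= 1.
    by rewrite ler_pdivrMr ?exprn_gt0// mul1r; apply: lerXn2r; rewrite // nnegrE ltW.
  have am20 : 0 <= a ^+ 2 / m ^+ 2 by rewrite divr_ge0 ?sqr_ge0.
  have x0 : 0 <= ((b ^+ 2 - a ^+ 2) ^+ 2 - d) / m ^+ 2.
    by rewrite divr_ge0 ?sqr_ge0 ?subr_ge0.
  have x1 : ((b ^+ 2 - a ^+ 2) ^+ 2 - d) / m ^+ 2 <= k ^+ 2 * (2 + k / m) ^+ 2.
    have -> : k ^+ 2 * (2 + k / m) ^+ 2 = (k * (2 * m + k)) ^+ 2 / m ^+ 2 by field.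
    rewrite ler_pM2r ?invr_gt0 ?exprn_gt0//.
    apply: (@le_trans _ _ ((b ^+ 2 - a ^+ 2) ^+ 2)); first by rewrite lerBlDr lerDl.
    have abs : `|b ^+ 2 - a ^+ 2| <= k * (2 * m + k).
      have ba : `|b - a| <= k.
        by rewrite (le_trans (ler_dist_dist _ _))// addrC addKr.
      have -> : b ^+ 2 - a ^+ 2 = (b - a) * (b + a) by ring.
      rewrite normrM (ger0_norm (addr_ge0 b0 a0)) ler_pM ?addr_ge0//; lra.
    rewrite -[leLHS]ger0_norm ?sqr_ge0// normrX; apply: lerXn2r => //.
    by rewrite nnegrE mulr_ge0//; lra.
  rewrite ger0_norm; last by rewrite addr_ge0// mulr_ge0 ?sqr_ge0// mulr_ge0.
  have k20 : 0 <= k ^+ 2 by rewrite sqr_ge0.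
  rewrite mulrDr lerD// mulrC ler_wpM2l//; lra.
rewrite /is_dx; apply: (@cvg_dist_squeeze _ _ _ _ _ _ _
  (fun h => `|h| * ((2 + `|h| / pnorm z) ^+ 2 + 2))).
  near=> h; rewrite sub0r normrN ger0_norm ?divr_ge0//.
  have hp : 0 < `|h| by rewrite normr_gt0; near: h; exact: nbhs_dnbhs_neq.
  by rewrite ler_pdivrMr// [leRHS]mulrAC -expr2; exact: key.
have c : `|h| @[h --> (0 : H)^'] --> (0 : R).
  rewrite -(normr0 H); apply: cvg_norm; apply: cvg_within_filter; exact: cvg_id.
rewrite -(mul0r ((2 + 0 / pnorm z) ^+ 2 + 2)); apply: cvgM => //.
apply: cvgD; last exact: cvg_cst.
apply: cvgXn; apply: cvgD; first exact: cvg_cst.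
by apply: cvgM => //; exact: cvg_cst.
Unshelve. all: by end_near. Qed.

Lemma dx_Upsilon2 z : cpath z ->
  dx ip Upsilon2 z = (4 * `|pend z| ^+ 2 / pnorm z ^+ 2) *: pend z.
Proof.
move=> cz; apply: xget_subset1; first exact: is_dx_Upsilon2.
by move=> B B'; exact: is_dx_unique.
Qed.

Lemma dx_Upsilon2_le z : cpath z -> `|dx ip Upsilon2 z| <= 4 * pnorm z.
Proof.
move=> cz; rewrite dx_Upsilon2// normrZ; have am := pnorm_pend cz.
have m0 := pnorm_ge0 cz.
have q0 : 0 <= `|pend z| ^+ 2 / pnorm z ^+ 2 by rewrite divr_ge0 ?sqr_ge0.
rewrite -(mulrA 4) (ger0_norm (mulr_ge0 (ler0n _ 4) q0)) -mulrA ler_wpM2l//.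
rewrite -[leRHS]mul1r ler_pM//.
have [->|mn0] := eqVneq (pnorm z) 0; first by rewrite expr0n /= invr0 mulr0.
have mp : 0 < pnorm z by rewrite lt_def mn0.
by rewrite ler_pdivrMr ?exprn_gt0// mul1r; apply: lerXn2r; rewrite // nnegrE.
Qed.

Section continuity.
Context {X : Type} {F : set_system X} {FF : Filter F}.
Variables (f : X -> path) (z : path).
Hypotheses (cf : \forall x \near F, cpath (f x)) (cz : cpath z).
Hypotheses (fn : pnorm (f x) @[x --> F] --> pnorm z)
  (fe : pend (f x) @[x --> F] --> pend z).

Lemma cvg_Upsilon2 : Upsilon2 (f x) @[x --> F] --> Upsilon2 z.
Proof.
have [m0|m0] := eqVneq (pnorm z) 0.
  have [U0 U1] := andP (Upsilon2_bounds cz).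
  have -> : Upsilon2 z = 0.
    by apply/eqP; rewrite eq_le Upsilon2_ge0// andbT (le_trans U1)// m0 expr0n mulr0.
  apply: (@cvg_dist_squeeze _ _ _ _ _ _ _ (fun x => 2 * pnorm (f x) ^+ 2)).
    apply: filterS cf => x cx; rewrite sub0r normrN ger0_norm ?Upsilon2_ge0//.
    by case/andP: (Upsilon2_bounds cx).
  suff : 2 * pnorm (f x) ^+ 2 @[x --> F] --> 2 * pnorm z ^+ 2.
    by rewrite m0 expr0n mulr0.
  by apply: cvgM; [exact: cvg_cst|exact: cvgXn].
apply: (cvg_trans (G := (pnorm (f x) ^+ 2 +
    `|pend (f x)| ^+ 4 / pnorm (f x) ^+ 2) @[x --> F])).
  by apply: near_eq_cvg; apply: filterS cf => x cx; rewrite Upsilon2E// pnorm_pend.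
rewrite Upsilon2E ?pnorm_pend//.
apply: cvgD; first exact: cvgXn.
apply: cvgM; first by apply: cvgXn; exact: cvg_norm.
by apply: cvgV; [rewrite expf_neq0|exact: cvgXn].
Qed.

Lemma cvg_dx_Upsilon2 : dx ip Upsilon2 (f x) @[x --> F] --> dx ip Upsilon2 z.
Proof.
have [m0|m0] := eqVneq (pnorm z) 0.
  have -> : dx ip Upsilon2 z = 0.
    by apply/eqP; rewrite -normr_le0 (le_trans (dx_Upsilon2_le cz))// m0 mulr0.
  apply: (@cvg_dist_squeeze _ _ _ _ _ _ _ (fun x => 4 * pnorm (f x))).
    by apply: filterS cf => x cx; rewrite sub0r normrN dx_Upsilon2_le.
  by rewrite -(mulr0 4) -m0; apply: cvgM => //; exact: cvg_cst.
apply: (cvg_trans (G := ((4 * `|pend (f x)| ^+ 2 / pnorm (f x) ^+ 2) *: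
    pend (f x)) @[x --> F])).
  by apply: near_eq_cvg; apply: filterS cf => x cx; rewrite dx_Upsilon2.
rewrite dx_Upsilon2//; apply: cvgZ => //; apply: cvgM.
  apply: cvgM; first exact: cvg_cst.
  by apply: cvgXn; exact: cvg_norm.
by apply: cvgV; [rewrite expf_neq0|exact: cvgXn].
Qed.

End continuity.
End dx_upsilon.
End upsilon.

(** * Weighted series *)

Section weighted_series.
Context {R : realType} {V : completeNormedModType R}.
Variable d : nat -> R.
Hypotheses (d0 : forall i, 0 <= d i) (cd : cvgn (series d)).

Lemma is_cvg_weighted (g : nat -> V) (C : R) : (forall i, `|g i| <= C) ->
  cvgn (series (fun i => d i *: g i)).
Proof.
move=> gC; have C0 : 0 <= C by exact: le_trans (gC 0%N).
apply: normed_cvg; apply: (@series_le_cvg _ _ (fun i => C * d i)) => //.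
- by move=> i; exact: normr_ge0.
- by move=> i; rewrite mulr_ge0.
- by move=> i; rewrite /= normrZ ger0_norm// mulrC ler_wpM2r.
- have -> : series (fun i => C * d i) = (fun n => C * series d n).
    by apply/funext => n; rewrite /series /= mulr_sumr.
  by apply: is_cvgM => //; exact: is_cvg_cst.
Qed.

Lemma weighted_tail_le (g : nat -> V) (C : R) N : (forall i, `|g i| <= C) ->
  `|limn (series (fun i => d i *: g i)) - series (fun i => d i *: g i) N| <=
  C * (limn (series d) - series d N).
Proof.
move=> gC; have cg := is_cvg_weighted gC.
have l1 : `|series (fun i => d i *: g i) n - series (fun i => d i *: g i) N|
    @[n --> \oo] --> `|limn (series (fun i => d i *: g i)) -
      series (fun i => d i *: g i) N|.
  by apply: cvg_norm; apply: cvgB => //; exact: cvg_cst.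
have l2 : C * (series d n - series d N) @[n --> \oo] -->
    C * (limn (series d) - series d N).
  by apply: cvgM; [exact: cvg_cst|apply: cvgB => //; exact: cvg_cst].
apply: (ler_cvg_to l1 l2); near=> n.
have Nn : (N <= n)%N by near: n; exact: nbhs_infty_ge.
rewrite !sub_series_geq// mulr_sumr (le_trans (ler_norm_sum _ _ _))//.
apply: ler_sum => i _; rewrite normrZ ger0_norm// mulrC.
by rewrite ler_wpM2r.
Unshelve. all: by end_near. Qed.

Lemma weighted_le (g : nat -> V) (C : R) : (forall i, `|g i| <= C) ->
  `|limn (series (fun i => d i *: g i))| <= C * limn (series d).
Proof.
move=> /(weighted_tail_le 0); rewrite /series /= !big_geq// !subr0; exact.
Qed.

(** Tannery's theorem: a series dominated by [C * d] passes to the limit term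
by term. *)
Lemma cvg_weighted {X : Type} {F : set_system X} {FF : ProperFilter F}
    (g : nat -> X -> V) (l : nat -> V) (C : R) :
  (\forall x \near F, forall i, `|g i x| <= C) ->
  (forall i, g i x @[x --> F] --> l i) ->
  limn (series (fun i => d i *: g i x)) @[x --> F] -->
  limn (series (fun i => d i *: l i)).
Proof.
move=> gC gl; have lC i : `|l i| <= C.
  apply: (cvgr_to_le (cvg_norm (gl i))).
  by apply: filterS gC => x; exact.
have C0 : 0 <= C by exact: le_trans (lC 0%N).
have finite N : series (fun i => d i *: g i x) N @[x --> F] -->
    series (fun i => d i *: l i) N.
  elim: N => [|N ih].
    by rewrite /series /= big_geq//; under eq_fun do rewrite big_geq//; exact: cvg_cst.
  rewrite seriesSr; under eq_fun do rewrite seriesSr.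
  by apply: cvgD => //; apply: cvgZr; exact: gl.
apply/cvgrPdist_le => e e0.
have e40 : 0 < e / (4 * (C + 1)) by rewrite divr_gt0// mulr_gt0// ltr_wpDl.
have [N _ /(_ N (leqnn N)) /= tail] := cvgr_dist_le _ _ cd _ e40.
have tC : C * (limn (series d) - series d N) <= e / 4.
  rewrite (le_trans (ler_wpM2l C0 (le_trans (ler_norm _) tail)))//.
  rewrite mulrA ler_pdivrMr; last by rewrite mulr_gt0// ltr_wpDl.
  have -> : e / 4 * (4 * (C + 1)) = C * e + e by field.
  by rewrite lerDl ltW.
near=> x.
have gx : forall i, `|g i x| <= C by near: x.
have fx : `|series (fun i => d i *: l i) N - series (fun i => d i *: g i x) N|
    <= e / 2.
  by near: x; apply: (cvgr_dist_le _ _ (finite N)); rewrite divr_gt0.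
have t1 := weighted_tail_le N lC; have t2 := weighted_tail_le N gx.
move: t1 t2 fx; set a := limn (series (fun i => d i *: l i)).
set b := series (fun i => d i *: l i) N.
set a' := limn (series (fun i => d i *: g i x)).
set b' := series (fun i => d i *: g i x) N => t1 t2 fx.
have -> : a - a' = (a - b) + (b - b') - (a' - b').
  by rewrite subrKA opprB subrKA.
rewrite (le_trans (ler_normB _ _))// (le_trans (lerD (ler_normD _ _) (lexx _)))//.
lra.
Unshelve. all: by end_near. Qed.

End weighted_series.

Section summability.
Context {R : realType}.

Lemma nneseries_leP (d : nat -> R) (N : R) : (forall i, 0 <= d i) ->
  (\sum_(0 <= i <oo) (d i)%:E <= N%:E)%E <-> (forall n, series d n <= N).
Proof.
move=> d0; split=> [h n|h].
  rewrite -lee_fin (le_trans _ h)// /series /= -sumEFin.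
  by apply: nneseries_lim_ge => i _ _; rewrite lee_fin.
apply: lime_le; first by apply: is_cvg_nneseries => i _ _; rewrite lee_fin.
by apply: nearW => n; rewrite sumEFin lee_fin; exact: h.
Qed.

Lemma is_cvg_nnseries (d : nat -> R) (N : R) : (forall i, 0 <= d i) ->
  (forall n, series d n <= N) -> cvgn (series d).
Proof.
move=> d0 dN; apply: nondecreasing_is_cvgn; first exact: nondecreasing_series.
by exists N => _ [n _ <-].
Qed.

End summability.

Section interleave.
Context {X : Type}.

(** A test functional carries a single sequence of penalties; a second one is
added by alternating the two. *)
Definition interleave (u w : nat -> X) (n : nat) : X :=
  if odd n then w n./2 else u n./2.

Lemma interleave_all (P : X -> Prop) (u w : nat -> X) :
  (forall n, P (u n)) -> (forall n, P (w n)) -> forall n, P (interleave u w n).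
Proof. by move=> Pu Pw n; rewrite /interleave; case: ifP. Qed.

End interleave.

Section interleave_series.
Context {R : realType} {V : normedModType R}.

Lemma series_interleave (u w : nat -> V) n :
  series (interleave u w) n = series u (uphalf n) + series w n./2.
Proof.
elim: n => [|n ih]; first by rewrite /series /= !big_geq// addr0.
rewrite seriesSr ih /interleave -[uphalf n.+1]/(n./2.+1) -[n.+1./2]/(uphalf n).
rewrite uphalf_half; case: (odd n); last by rewrite add0n (seriesSr u) addrAC.
by rewrite add1n (seriesSr w) addrA.
Qed.

Lemma cvg_series_interleave (u w : nat -> V) :
  cvgn (series u) -> cvgn (series w) ->
  series (interleave u w) @ \oo --> limn (series u) + limn (series w).
Proof.
move=> cu cw; have -> : series (interleave u w) =
    (fun n => series u (uphalf n) + series w n./2).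
  by apply/funext => n; exact: series_interleave.
have hoo : n./2 @[n --> \oo] --> \oo.
  move=> P [N _ NP]; exists N.*2 => // n /= Nn; apply: NP => /=.
  by rewrite -(doubleK N) half_leq.
have uoo : uphalf n @[n --> \oo] --> \oo.
  move=> P [N _ NP]; exists N.*2 => // n /= Nn; apply: NP => /=.
  by rewrite -(doubleK N) uphalf_half (leq_trans (half_leq Nn))// leq_addl.
by apply: cvgD; [exact: (cvg_comp _ _ uoo cu)|exact: (cvg_comp _ _ hoo cw)].
Qed.

End interleave_series.

(** * The topology of d_infinity and the completeness of path space *)

Section dinf_topology.
Context {R : realType} {H : completeNormedModType R}.
Local Notation path := (hpath H).
Implicit Types (z y : path) (t s : R) (Q : set path).
Variables (T : R) (E : R -> H -> H).
Hypotheses (T0 : 0 <= T) (sgE : C0_semigroup E) (cE : contraction_semigroup E).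

Local Notation ext z := (pextendA E z T).
Local Notation dist := (dinf T E).
Local Notation gap := (gap E).

Lemma ext_dist_le z z' s : cpath z -> cpath z' ->
  `|ext z s - ext z' s| <= dist z z'.
Proof.
move=> cz cz'; have ce := cpath_pextendA sgE cE T0 cz.
have ce' := cpath_pextendA sgE cE T0 cz'.
have := pnorm_ub s (cpath_psub ce ce'); rewrite psubE//.
have [_ <- _] := ce' => /le_trans; apply.
by rewrite /dinf lerDr.
Qed.

Lemma ptime_dist_le z z' : cpath z -> cpath z' ->
  `|ptime z - ptime z'| <= dist z z'.
Proof.
move=> cz cz'; rewrite /dinf lerDl pnorm_ge0//.
by apply: cpath_psub; exact: cpath_pextendA.
Qed.

Lemma dinf_ge0 z z' : cpath z -> cpath z' -> 0 <= dist z z'.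
Proof. by move=> cz cz'; apply: le_trans (ptime_dist_le cz cz'). Qed.

Lemma dinf_refl z : cpath z -> dist z z = 0.
Proof.
move=> cz; have cp := cpath_psub (cpath_pextendA sgE cE T0 cz)
  (cpath_pextendA sgE cE T0 cz).
apply/eqP; rewrite eq_le dinf_ge0// andbT /dinf subrr normr0 add0r.
by apply: pnorm_le => // s _; rewrite /= subrr normr0.
Qed.

Lemma dinf_sym z z' : cpath z -> cpath z' -> dist z z' = dist z' z.
Proof.
move=> cz cz'; rewrite /dinf distrC; congr (_ + _); apply: pnorm_psubC => //;
exact: cpath_pextendA.
Qed.

Lemma pnorm_gap_lip z z' y : cpath z -> cpath z' -> cpath y ->
  ptime y <= ptime z <= T -> ptime y <= ptime z' <= T ->
  `|pnorm (gap z y) - pnorm (gap z' y)| <= dist z z'.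
Proof.
have hw u u' : cpath u -> cpath u' -> cpath y ->
    ptime y <= ptime u <= T -> ptime y <= ptime u' <= T ->
    pnorm (gap u y) - pnorm (gap u' y) <= dist u u'.
  move=> cu cu' cy yu yu'; rewrite (pnorm_gap T0 sgE cE cu cy yu).
  rewrite (pnorm_gap T0 sgE cE cu' cy yu') lerBlDr.
  apply: (le_trans (pnorm_psub_triangle (y := ext u') _ _ _ _ _)) => //;
    try exact: cpath_pextendA.
  by rewrite lerD2r /dinf lerDr.
move=> cz cz' cy yz yz'; rewrite ler_norml lerNl opprB hw//.
by rewrite dinf_sym// hw.
Qed.

Lemma pnorm_lip z z' : cpath z -> cpath z' -> ptime z <= T -> ptime z' <= T ->
  `|pnorm z - pnorm z'| <= dist z z'.
Proof.
move=> cz cz' zT zT'; have c0 := @cpath_null R H.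
have := pnorm_gap_lip cz cz' c0; rewrite !gap_null//; apply.
- by rewrite zT andbT; case: cz.
- by rewrite zT' andbT; case: cz'.
Qed.

Lemma pnorm_gap_le z y : cpath z -> cpath y ->
  pnorm (gap z y) <= pnorm z + pnorm y.
Proof.
move=> cz cy; have cg := cpath_gap sgE cE cz cy; have [z0 _ _] := cz.
apply: pnorm_le => // s sI; rewrite /gap psubE// [clamp _ s]clamp_id//.
rewrite (le_trans (ler_normB _ _))// lerD ?pnorm_ub// pextendAE//.
by rewrite (le_trans (cE _ _)) ?le_max ?lexx// pnorm_ub.
Qed.

(** Neighbourhoods for [d_infinity] are given as a filter so that the calculus of
limits applies to functionals of paths. *)
Definition dnear Q z : set_system path :=
  filter_from [set e : R | 0 < e] (fun e => [set z' | Q z' /\ dist z z' < e]).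

Global Instance dnear_filter Q z : Filter (dnear Q z).
Proof.
apply: filter_from_filter; first by exists 1 => /=.
move=> e e' /= e0 e0'; exists (Num.min e e') => /=; first by rewrite lt_min e0.
by move=> z' /= [Qz']; rewrite lt_min => /andP[].
Qed.

Lemma dnear_proper Q z : Q z -> cpath z -> ProperFilter (dnear Q z).
Proof.
move=> Qz cz; apply: (filter_from_proper (dnear_filter Q z)).
by move=> e /= e0; exists z; rewrite /= dinf_refl.
Qed.

Lemma dnear_in Q z : \forall z' \near dnear Q z, Q z'.
Proof. by exists 1 => //= z' []. Qed.

Lemma dnear_dist Q z e : 0 < e -> \forall z' \near dnear Q z, dist z z' < e.
Proof. by move=> e0; exists e => //= z' []. Qed.

Lemma C0_cvg {V : normedModType R} Q (f : path -> V) z :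
  C0 T E Q f -> Q z -> f z' @[z' --> dnear Q z] --> f z.
Proof.
move=> cf Qz; apply/cvgrPdist_lt => e e0; have [d d0 fd] := cf z Qz e e0.
by exists d => //= z' [Qz' dz']; rewrite distrC; exact: fd.
Qed.

Lemma cvg_C0 {V : normedModType R} Q (f : path -> V) :
  (forall z, Q z -> f z' @[z' --> dnear Q z] --> f z) -> C0 T E Q f.
Proof.
move=> cf z Qz e e0; have /cvgrPdist_lt/(_ e e0)[d /= d0 fd] := cf z Qz.
by exists d => // z' Qz' dz'; rewrite distrC; exact: (fd z' (conj Qz' dz')).
Qed.

Lemma dnear_sub Q Q' z : Q' `<=` Q -> dnear Q' z --> dnear Q z.
Proof.
by move=> QQ P [e e0 eP]; exists e => // z' [/QQ Qz' dz']; exact: eP.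
Qed.

Section continuity.
Variables (t : R) (z : path).
Hypotheses (t0 : 0 <= t) (Lz : Lambda T t z).
Local Notation near := (dnear (Lambda T t) z).

Let cz : cpath z. Proof. exact: Lambda_cpath Lz. Qed.
Let zT : t <= ptime z <= T. Proof. by have /LambdaP[] := Lz. Qed.

Lemma cvg_dist_dnear : dist z z' @[z' --> near] --> (0 : R).
Proof.
apply/cvgrPdist_le => e e0; have := dnear_dist (Lambda T t) z e0.
apply: filterS2 (dnear_in _ _) => z' /Lambda_cpath cz' dz'.
by rewrite sub0r normrN ger0_norm ?dinf_ge0// ltW.
Qed.

Lemma cvg_ptime : ptime z' @[z' --> near] --> ptime z.
Proof.
apply: cvg_dist_squeeze cvg_dist_dnear.
apply: filterS (dnear_in _ _) => z' /Lambda_cpath cz'.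
by rewrite ptime_dist_le.
Qed.

(** As the end time varies as well, the end points are compared through the
prolongation of [z] at the time of [z']. *)
Lemma cvg_pend : pend z' @[z' --> near] --> pend z.
Proof.
have [z0 _ _] := cz; have ez : pend z = ext z (ptime z).
  by rewrite (@ext_id _ _ T E sgE z)// ?lexx ?z0//; case/andP: zT.
have c : ext z (ptime z') @[z' --> near] --> ext z (ptime z).
  have [_ _ ce] := cpath_pextendA sgE cE T0 cz.
  exact: (cvg_comp _ _ cvg_ptime (ce _)).
rewrite ez; apply: (@cvg_dist_squeeze _ _ _ _ _ _ _ (fun z' =>
    `|ext z (ptime z) - ext z (ptime z')| + dist z z')); last first.
  by rewrite -(addr0 0); apply: cvgD cvg_dist_dnear; exact: cvg_dist0.
apply: filterS (dnear_in _ _) => z' /LambdaP[cz' /andP[tz' zT']].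
have [z0' _ _] := cz'.
have -> : pend z' = ext z' (ptime z').
  by rewrite (@ext_id _ _ T E sgE z')// z0' lexx.
rewrite -(subrKA (ext z (ptime z'))) (le_trans (ler_normD _ _))// lerD2l.
by rewrite ext_dist_le.
Qed.

Variable y : path.
Hypotheses (cy : cpath y) (yt : ptime y <= t).

Lemma cvg_pnorm_gap : pnorm (gap z' y) @[z' --> near] --> pnorm (gap z y).
Proof.
apply: cvg_dist_squeeze cvg_dist_dnear.
apply: filterS (dnear_in _ _) => z' /LambdaP[cz' /andP[tz' zT']].
rewrite pnorm_gap_lip// ?zT' ?(le_trans yt tz')//.
by case/andP: zT => /(le_trans yt) -> ->.
Qed.

Lemma cvg_pend_gap : pend (gap z' y) @[z' --> near] --> pend (gap z y).
Proof.
rewrite (@pend_gap _ _ T)//; last by case/andP: zT.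
apply: (cvg_trans (G := (pend z' - ext y (ptime z')) @[z' --> near])).
  apply: near_eq_cvg; apply: filterS (dnear_in _ _).
  by move=> z' /LambdaP[cz' /andP[_ zT']]; rewrite (@pend_gap _ _ T).
apply: cvgB; first exact: cvg_pend.
have [_ _ ce] := cpath_pextendA sgE cE T0 cy.
exact: (cvg_comp _ _ cvg_ptime (ce _)).
Qed.

Let cgap : \forall z' \near near, cpath (gap z' y).
Proof.
by apply: filterS (dnear_in _ _) => z' /Lambda_cpath cz'; exact: cpath_gap.
Qed.

Lemma cvg_Upsilon2_gap :
  Upsilon2 (gap z' y) @[z' --> near] --> Upsilon2 (gap z y).
Proof.
exact: cvg_Upsilon2 cgap (cpath_gap sgE cE cz cy) cvg_pnorm_gap cvg_pend_gap.
Qed.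

Lemma cvg_dx_Upsilon2_gap (ip : {dot H for (@idfun R)}) :
  (forall x : H, `|x| ^+ 2 = ip x x) ->
  dx ip Upsilon2 (gap z' y) @[z' --> near] --> dx ip Upsilon2 (gap z y).
Proof.
move=> ipn; apply: cvg_dx_Upsilon2 cgap _ cvg_pnorm_gap cvg_pend_gap => //.
exact: cpath_gap.
Qed.

End continuity.

(** The gauge of the variational principle: it controls [d_infinity] but,
unlike it, is vertically differentiable. *)
Definition gauge z y : R := Upsilon2 (gap z y) + `|ptime z - ptime y| ^+ 2.

Lemma cvg_gauge t z y : 0 <= t -> Lambda T t z -> cpath y -> ptime y <= t ->
  gauge z' y @[z' --> dnear (Lambda T t) z] --> gauge z y.
Proof.
move=> t0 Lz cy yt; apply: cvgD; first exact: cvg_Upsilon2_gap.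
apply: cvgXn; apply: cvg_norm; apply: cvgB; first exact: cvg_ptime.
exact: cvg_cst.
Qed.

Lemma gauge_ge0 z y : cpath z -> cpath y -> 0 <= gauge z y.
Proof.
by move=> cz cy; rewrite addr_ge0 ?Upsilon2_ge0 ?sqr_ge0//; exact: cpath_gap.
Qed.

Lemma gauge_refl z : cpath z -> ptime z <= T -> gauge z z = 0.
Proof.
move=> cz zT; have cg := cpath_gap sgE cE cz cz; have [z0 _ _] := cz.
have g0 : pnorm (gap z z) = 0.
  apply/eqP; rewrite eq_le pnorm_ge0// andbT; apply: pnorm_le => // s _.
  by rewrite (@gapE _ _ T)// subrr normr0.
rewrite /gauge subrr normr0 expr0n addr0; apply/eqP.
rewrite eq_le Upsilon2_ge0// andbT; have /andP[_] := Upsilon2_bounds cg.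
by rewrite g0 expr0n mulr0.
Qed.

Lemma gauge_le z y (c : R) : cpath z -> cpath y -> 0 <= c ->
  gauge z y <= c ^+ 2 -> pnorm (gap z y) <= c /\ `|ptime z - ptime y| <= c.
Proof.
move=> cz cy c0 gc; have cg := cpath_gap sgE cE cz cy.
have /andP[Ul _] := Upsilon2_bounds cg; have t0 := sqr_ge0 `|ptime z - ptime y|.
have U0 := Upsilon2_ge0 cg; rewrite /gauge in gc.
by split; rewrite -(@ler_pXn2r _ 2)// ?nnegrE ?pnorm_ge0//; lra.
Qed.

Lemma gauge_dist_le z y (c : R) : cpath z -> cpath y -> 0 <= c ->
  ptime y <= ptime z <= T -> gauge z y <= c ^+ 2 -> dist z y <= 2 * c.
Proof.
move=> cz cy c0 yz /gauge_le[]// gc tc; rewrite dinf_gap//; lra.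
Qed.

Lemma gauge_ub z y : cpath z -> cpath y -> ptime y <= ptime z <= T ->
  gauge z y <= 2 * (pnorm z + pnorm y) ^+ 2 + T ^+ 2.
Proof.
move=> cz cy /andP[yz zT]; have cg := cpath_gap sgE cE cz cy.
have /andP[_ Ul] := Upsilon2_bounds cg; have [y0 _ _] := cy.
have m0 := pnorm_ge0 cg; apply: lerD.
  apply: (le_trans Ul); rewrite ler_pM2l//.
  by apply: lerXn2r; rewrite ?nnegrE ?addr_ge0 ?pnorm_ge0// pnorm_gap_le.
rewrite ger0_norm ?subr_ge0//; apply: lerXn2r; rewrite ?nnegrE ?subr_ge0//; lra.
Qed.

End dinf_topology.

(** * Completeness of path space and the variational principle *)

Section geometric.
Context {R : realType}.
Local Notation half n := ((2^-1 : R) ^+ n).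

Lemma half_gt0 n : 0 < half n.
Proof. by rewrite exprn_gt0// invr_gt0. Qed.

Lemma half_ge0 n : 0 <= half n.
Proof. exact: ltW (half_gt0 n). Qed.

Lemma half_le1 n : half n <= 1.
Proof. by rewrite exprn_ile1 ?invr_ge0// invf_le1// ler1n. Qed.

Lemma series_half n : series (fun i => half i) n = 2 - 2 * half n.
Proof.
elim: n => [|n ih]; first by rewrite /series /= big_geq// expr0 mulr1 subrr.
by rewrite seriesSr ih exprS; field.
Qed.

Lemma cvg_half : half n @[n --> \oo] --> (0 : R).
Proof. by apply: cvg_expr; rewrite ger0_norm ?invr_ge0// invf_lt1// ltr1n. Qed.

Lemma cvg_series_half : series (fun i => half i) @ \oo --> (2 : R).
Proof.
have -> : series (fun i => half i) = (fun n => 2 - 2 * half n).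
  by apply/funext => n; exact: series_half.
suff : 2 - 2 * half n @[n --> \oo] --> 2 - 2 * (0 : R) by rewrite mulr0 subr0.
by apply: cvgB; [exact: cvg_cst|apply: cvgM; [exact: cvg_cst|exact: cvg_half]].
Qed.

Lemma half_squeeze (x C : R) : (forall n, x <= C * half n) -> x <= 0.
Proof.
move=> xC; rewrite -(mulr0 C).
apply: (ler_cvg_to (cvg_cst x) (cvgM (cvg_cst C) cvg_half)).
by apply: nearW => n; exact: xC.
Qed.

Lemma half_cauchy {V : completeNormedModType R} (u : nat -> V) (D : R) :
  (forall i, `|u i.+1 - u i| <= D * half i) ->
  exists l, forall i, `|l - u i| <= 2 * D * half i.
Proof.
move=> uD; pose g i := (half i)^-1 *: (u i.+1 - u i).
have gD i : `|g i| <= D.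
  rewrite normrZ ger0_norm ?invr_ge0 ?half_ge0//.
  by rewrite mulrC ler_pdivrMr ?half_gt0.
have sE n : series (fun i => half i *: g i) n = u n - u 0%N.
  elim: n => [|n ih]; first by rewrite /series /= big_geq// subrr.
  by rewrite seriesSr ih /g scalerA divff ?gt_eqF ?half_gt0// scale1r addrC subrKA.
exists (u 0%N + limn (series (fun i => half i *: g i))) => i.
have -> : u 0%N + limn (series (fun i => half i *: g i)) - u i =
    limn (series (fun i => half i *: g i)) - series (fun i => half i *: g i) i.
  by rewrite sE opprB addrA [X in X - _]addrC.
have := weighted_tail_le (d := fun i => half i) half_ge0 (cvgP _ cvg_series_half) i gD.
rewrite (cvg_lim _ cvg_series_half)// series_half => /le_trans; apply.
by rewrite le_eqVlt; apply/orP; left; apply/eqP; ring.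
Qed.

End geometric.

Section completeness.
Context {R : realType} {H : completeNormedModType R}.
Local Notation path := (hpath H).
Variables (T : R) (E : R -> H -> H).
Hypotheses (T0 : 0 <= T) (sgE : C0_semigroup E) (cE : contraction_semigroup E).
Local Notation ext z := (pextendA E z T).
Local Notation half n := ((2^-1 : R) ^+ n).

(** The prolongations converge uniformly on [[0, T]], and the limit follows the
semigroup after the limit time, so that it is the prolongation of a path. *)
Lemma Lambda_complete (t D : R) (zs : nat -> path) : 0 <= t ->
  (forall i, Lambda T t (zs i)) ->
  (forall i, ptime (zs i) <= ptime (zs i.+1)) ->
  (forall i, dinf T E (zs i.+1) (zs i) <= D * half i) ->
  exists z, [/\ Lambda T t z, forall i, ptime (zs i) <= ptime z &
    forall i, dinf T E z (zs i) <= 4 * D * half i].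
Proof.
move=> t0 Lz tz dz; have cz i : cpath (zs i) := Lambda_cpath (Lz i).
have zT i : ptime (zs i) <= T by have /LambdaP[_ /andP[]] := Lz i.
have ce i := cpath_pextendA sgE cE T0 (cz i).
have [ts tsP] : exists ts, forall i, `|ts - ptime (zs i)| <= 2 * D * half i.
  apply: (half_cauchy (V := R^o)) => i; apply: le_trans (dz i).
  exact: ptime_dist_le.
have /choice[f fP] : forall s, exists l, forall i,
    `|l - ext (zs i) s| <= 2 * D * half i.
  move=> s; apply: half_cauchy => i; apply: le_trans (dz i).
  exact: ext_dist_le.
have mono i j : ptime (zs i) <= ptime (zs (i + j)%N).
  elim: j => [|j]; first by rewrite addn0.
  by move=> /le_trans; apply; rewrite addnS; exact: tz.
have D0 : 0 <= D.
  have := dz 0%N; rewrite expr0 mulr1; apply: le_trans; exact: dinf_ge0.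
have tle i : ptime (zs i) <= ts.
  rewrite -subr_le0; apply: (@half_squeeze _ _ (2 * D)) => j.
  apply: (@le_trans _ _ (ptime (zs (i + j)%N) - ts)); first by rewrite lerB.
  rewrite (le_trans (ler_norm _))// distrC (le_trans (tsP _))//.
  by rewrite ler_wpM2l ?mulr_ge0// exprD ler_piMl ?half_ge0 ?half_le1.
have tsT : ts <= T.
  rewrite -subr_le0; apply: (@half_squeeze _ _ (2 * D)) => j.
  have := le_trans (ler_norm _) (tsP j); have := zT j; lra.
have tts : t <= ts.
  by have /LambdaP[_ /andP[+ _]] := Lz 0%N => /le_trans; apply; exact: tle.
have ts0 := le_trans t0 tts.
have fc : continuous f.
  move=> s; apply/cvgrPdist_le => e e0.
  have [i iP] : exists i, 2 * D * half i <= e / 3.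
    apply: contrapT => /forallNP h; have : e / 3 <= 0.
      apply: (@half_squeeze _ _ (2 * D)) => n.
      by have /negP := h n; rewrite -ltNge => /ltW.
    lra.
  have [_ _ /(_ s) ec] := ce i.
  have e30 : 0 < e / 3 by lra.
  near=> r.
  have h : `|ext (zs i) s - ext (zs i) r| <= e / 3.
    by near: r; exact: (cvgr_dist_le _ _ ec).
  have h1 := fP s i; have h2 := fP r i.
  have -> : f s - f r = (f s - ext (zs i) s) + (ext (zs i) s - ext (zs i) r) -
     (f r - ext (zs i) r).
    by rewrite subrKA opprB subrKA.
  rewrite (le_trans (ler_normB _ _))// (le_trans (lerD (ler_normD _ _) (lexx _)))//.
  lra.
pose z := mkpath ts f; have cz' : cpath z by exact: cpath_mkpath.
have extz s : 0 <= s <= T -> ext z s = f s.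
  move=> /andP[s0 sT]; have [st|/ltW st] := leP s ts.
    by rewrite (ext_id sgE cz')//= ?s0// clamp_id// s0.
  rewrite (ext_flow sgE cz' (lexx _)) ?st// (ext_id sgE cz')//= ?lexx ?ts0//.
  rewrite clamp_id ?lexx ?ts0//.
  apply/eqP; rewrite -subr_eq0 -normr_le0.
  apply: (@half_squeeze _ _ (4 * D)) => i.
  have -> : E (s - ts) (f ts) - f s =
     E (s - ts) (f ts - ext (zs i) ts) - (f s - ext (zs i) s).
    rewrite (ext_flow sgE (cz i) (tle i) (s := s)) ?st//.
    by rewrite (semigroupB sgE) ?subr_ge0// opprB subrKA.
  rewrite (le_trans (ler_normB _ _))//.
  have h1 := fP s i; have h2 := fP ts i.
  have h3 := cE (f ts - ext (zs i) ts) (_ : 0 <= s - ts).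
  have := h3; rewrite subr_ge0 => /(_ st) h4.
  by have := le_trans h4 h2; lra.
exists z; split=> // [|i]; first by apply/LambdaP; rewrite tts tsT.
have -> : 4 * D * half i = 2 * D * half i + 2 * D * half i by ring.
apply: lerD; first exact: tsP.
apply: pnorm_le => // s sI; rewrite psubE//; last exact: cpath_pextendA.
by rewrite [clamp _ s]clamp_id// extz.
Unshelve. all: by end_near. Qed.

End completeness.

Section borwein_preiss.
Context {R : realType} {X : Type}.
Local Notation half n := ((2^-1 : R) ^+ n).
Variables (L : X -> set X) (rho : X -> X -> R).
Variable (x0 : X).
Hypothesis L0 : L x0 x0.
Hypothesis L_refl : forall x, L x0 x -> L x x.
Hypothesis L_trans : forall x y z, L x y -> L y z -> L x z.
Hypothesis rho_ge0 : forall x y, L x0 x -> L x y -> 0 <= rho y x.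
Hypothesis rho_refl : forall x, L x0 x -> rho x x = 0.
Variable to : (nat -> X) -> X -> Prop.
Variable k : R.
Hypothesis complete : forall xs : nat -> X,
  (forall i, L x0 (xs i)) -> (forall i, L (xs i) (xs i.+1)) ->
  (forall i, rho (xs i.+1) (xs i) <= k * half i * half i) ->
  exists x, (forall i, L (xs i) x) /\ to xs x.
Variable f : X -> R.
Hypothesis f_cvg : forall xs x, (forall i, L x0 (xs i)) -> L x0 x ->
  to xs x -> f (xs n) @[n --> \oo] --> f x.
Hypothesis rho_cvg : forall xs x i, (forall j, L x0 (xs j)) ->
  (forall j, L (xs j) (xs j.+1)) -> (forall j, L (xs j) x) ->
  to xs x -> rho (xs n) (xs i) @[n --> \oo] --> rho x (xs i).
Hypothesis f_max : forall x, L x0 x -> f x <= f x0 + k.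

Local Notation kap i := (k * half i * half i * half i).

Let k_ge0 : 0 <= k.
Proof. by have := f_max L0; rewrite lerDl. Qed.

Let kap_gt0 i : 0 < k -> 0 < kap i.
Proof. by move=> k0; rewrite !mulr_gt0 ?half_gt0. Qed.

(** One step of the construction: penalising the current almost maximiser [x]
of [g] leaves its value unchanged, so that a better almost maximiser among the
later points can only be close to [x]. *)
Lemma penalised_step (g : X -> R) (x : X) (d e : R) : L x0 x -> 0 <= d -> 0 < e ->
  (exists M, forall y, L x y -> g y <= M) ->
  exists y, [/\ L x y, g x <= g y - d * rho y x &
    forall z, L y z -> g z - d * rho z x <= g y - d * rho y x + e].
Proof.
move=> Lx d0 e0 [M gM]; pose h y := g y - d * rho y x.
have hx : h x = g x by rewrite /h rho_refl// mulr0 subr0.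
pose S := [set h y | y in L x].
have supS : has_sup S.
  split; first by exists (h x), x => //; exact: L_refl.
  exists M => _ [y Ly <-]; rewrite (le_trans _ (gM y Ly))// lerBlDr lerDl.
  by rewrite mulr_ge0// rho_ge0.
have [_ [y Ly <-] yS] := sup_adherent e0 supS.
have ubS z : L x z -> h z <= sup S by move=> Lz; apply: ub_le_sup; [case: supS|exists z].
have [hxy|/ltW hyx] := leP (h x) (h y).
  exists y; split=> //; first by rewrite -hx.
  move=> z Lz; apply: (le_trans (ubS z (L_trans Ly Lz))).
  by rewrite -lerBlDr ltW.
exists x; split; [exact: L_refl|by rewrite -/(h x) hx|].
move=> z Lz; apply: (le_trans (ubS z Lz)); rewrite -/(h x) -lerBlDr.
exact: le_trans (ltW yS) hyx.
Qed.

Hypothesis k_gt0 : 0 < k.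

(** The weights are [2^-i] and the tolerances [k 8^-i], so that the gauge between
consecutive points is at most [k 4^-i] and has a summable square root. *)
Lemma penalised_sequence : exists (g : nat -> X -> R) (xs : nat -> X),
  [/\ g 0%N = f, xs 0%N = x0,
      forall i, L (xs i) (xs i.+1),
      forall i y, g i.+1 y = g i y - half i * rho y (xs i) &
      forall i, g i (xs i) <= g i.+1 (xs i.+1) /\
        forall y, L (xs i) y -> g i y <= g i (xs i) + kap i].
Proof.
pose inv (s : nat * (X -> R) * X) := L x0 s.2 /\
  forall y, L s.2 y -> s.1.2 y <= s.1.2 s.2 + kap s.1.1.
pose next (s s' : {s | inv s}) := [/\ (sval s').1.1 = (sval s).1.1.+1,
  forall y, (sval s').1.2 y =
    (sval s).1.2 y - half (sval s).1.1 * rho y (sval s).2,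
  L (sval s).2 (sval s').2 &
  (sval s).1.2 (sval s).2 <= (sval s').1.2 (sval s').2].
have nextP s : {s' | next s s'}.
  apply: cid; case: s => -[[i g] x] [/= Lx gx].
  have [|y [Ly xy yz]] := @penalised_step g x (half i) (kap i.+1) Lx (half_ge0 i)
      (kap_gt0 _ k_gt0).
    by exists (g x + kap i).
  have invy : inv (i.+1, (fun z => g z - half i * rho z x), y).
    by split=> //=; exact: L_trans Ly.
  by exists (exist _ _ invy).
have inv0 : inv (0%N, f, x0) by split=> //= y Ly; rewrite expr0 !mulr1 f_max.
have [s [s0 sn]] := dependent_choice nextP (exist _ _ inv0).
have idx i : (sval (s i)).1.1 = i.
  by elim: i => [|i ih]; [rewrite s0|have [-> _ _ _] := sn i; rewrite ih].
exists (fun i => (sval (s i)).1.2), (fun i => (sval (s i)).2).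
split; rewrite ?s0// => i.
- by have [_ _ ? _] := sn i.
- by move=> y; have [_ h _ _] := sn i; have := h y; rewrite idx.
- have [_ _ _ ?] := sn i; split=> // y.
  by have [_ h] := svalP (s i); have := h y; rewrite idx.
Qed.

(** The Borwein-Preiss principle: [x0], a maximum point of [f] up to [k], is
moved to a nearby maximum point of a penalised functional. The values of the
penalised functionals at the successive points increase and their oscillations
at later points tend to 0, so the limit point is maximal. Only later points are
compared, because the gauge is not meaningful for the others. *)
Lemma borwein_preiss : exists (xs : nat -> X) (x : X),
  [/\ xs 0%N = x0, forall i, L x0 (xs i), forall i, L (xs i) x,
      forall i, rho x (xs i) <= k &
      forall y, L x y -> cvgn (series (fun i => half i * rho y (xs i))) ->
        f y - limn (series (fun i => half i * rho y (xs i))) <=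
        f x - limn (series (fun i => half i * rho x (xs i)))].
Proof.
have [g [xs [g0 xs0 Lxs gS gxs]]] := penalised_sequence.
have Lij i j : L (xs i) (xs (i + j)%N).
  elim: j => [|j ih]; last by rewrite addnS; exact: L_trans ih (Lxs _).
  rewrite addn0; apply: L_refl; elim: i => [|i ih]; first by rewrite xs0.
  exact: L_trans ih (Lxs i).
have Lx0 i : L x0 (xs i) by have := Lij 0%N i; rewrite xs0.
have gE i y : g i y = f y - series (fun i => half i * rho y (xs i)) i.
  elim: i => [|i ih]; first by rewrite g0 /series /= big_geq// subr0.
  by rewrite gS ih seriesSr opprD addrA.
have gle i y : L (xs i) y -> g i.+1 y <= g i y.
  move=> Ly; rewrite gS lerBlDr lerDl mulr_ge0 ?half_ge0//.
  exact: rho_ge0.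
have gle' i j y : L (xs (i + j)%N) y -> g (i + j)%N y <= g i y.
  elim: j => [|j ih]; first by rewrite addn0.
  rewrite addnS => Ly; have Ly' := L_trans (Lxs _) Ly.
  exact: le_trans (gle _ _ Ly') (ih Ly').
have near_next i : rho (xs i.+1) (xs i) <= k * half i * half i.
  have [h1 /(_ _ (Lxs i)) h2] := gxs i; rewrite gS in h1.
  rewrite -(ler_pM2l (half_gt0 i)) [leRHS]mulrC; lra.
have [x [Lx xsx]] := complete Lx0 Lxs near_next.
have L0x : L x0 x by rewrite -xs0.
have mono i j : g i (xs i) <= g (i + j)%N (xs (i + j)%N).
  elim: j => [|j ih]; first by rewrite addn0.
  by rewrite addnS; apply: (le_trans ih); have [] := gxs (i + j)%N.
have g_cvg i : g i (xs n) @[n --> \oo] --> g i x.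
  elim: i => [|i ih]; first by rewrite g0; exact: f_cvg.
  rewrite gS; under eq_fun do rewrite gS.
  by apply: cvgB => //; apply: cvgM; [exact: cvg_cst|exact: rho_cvg].
have gx i j : g i (xs i) <= g j x.
  apply: (cvgr_to_ge (g_cvg j)); near=> n.
  have inn : (i <= n)%N by near: n; exact: nbhs_infty_ge.
  have jn : (j <= n)%N by near: n; exact: nbhs_infty_ge.
  have h1 := mono i (n - i)%N; rewrite subnKC// in h1.
  have h2 := @gle' j (n - j)%N (xs n); rewrite subnKC// in h2.
  by apply: (le_trans h1); apply: h2; apply: L_refl.
have near_x i : rho x (xs i) <= k * half i * half i.
  have [_ /(_ _ (Lx i)) h2] := gxs i; have h1 := gx i i.+1; rewrite gS in h1.
  rewrite -(ler_pM2l (half_gt0 i)) [leRHS]mulrC; lra.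
have near_k i : rho x (xs i) <= k.
  by rewrite (le_trans (near_x i))// -mulrA ler_piMr// mulr_ile1 ?half_ge0 ?half_le1.
have cx : cvgn (series (fun i => half i * rho x (xs i))).
  apply: (@is_cvg_weighted _ R^o _ half_ge0 (cvgP _ cvg_series_half) _ k) => i.
  by rewrite /= ger0_norm ?near_k// rho_ge0.
exists xs, x; split=> // y Ly cy.
rewrite -subr_le0; apply: (@half_squeeze _ _ k) => i.
have yi : f y - limn (series (fun i => half i * rho y (xs i))) <= g i y.
  rewrite gE lerB//; apply: nondecreasing_cvgn_le => //.
  apply: nondecreasing_series => j _ _; rewrite mulr_ge0 ?half_ge0// rho_ge0//.
  exact: L_trans Ly.
have [_ /(_ _ (L_trans (Lx i) Ly)) yi'] := gxs i.
have xi : g i (xs i) <= f x - limn (series (fun i => half i * rho x (xs i))).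
  have c : f x - series (fun i => half i * rho x (xs i)) j @[j --> \oo] -->
      f x - limn (series (fun i => half i * rho x (xs i))).
    by apply: cvgB cx; exact: cvg_cst.
  apply: (cvgr_to_ge c).
  by apply: nearW => j /=; have := gx i j; rewrite (gE j).
have : kap i <= k * half i.
  by rewrite -!mulrA ler_wpM2l ?k_ge0// ler_piMr ?half_ge0// mulr_ile1 ?half_ge0 ?half_le1.
lra.
Unshelve. all: by end_near. Qed.

End borwein_preiss.

(** * Perturbed test functionals *)

Section perturbation.
Context {R : realType} {H : completeNormedModType R}.
Local Notation path := (hpath H).
Implicit Types (z y x : path) (t s : R) (Q : set path).
Variables (T : R) (E : R -> H -> H).
Hypotheses (T0 : 0 <= T) (sgE : C0_semigroup E) (cE : contraction_semigroup E).
Local Notation half n := ((2^-1 : R) ^+ n).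
Local Notation dist := (dinf T E).
Local Notation near := (dnear T E).

Lemma dnear_sub_near Q Q' z : (\forall z' \near near Q' z, Q z') ->
  near Q' z --> near Q z.
Proof.
move=> QQ P [e /= e0 eP]; have := dnear_dist T E Q' z e0.
by apply: filterS2 QQ => z' Qz' dz'; apply: eP.
Qed.

Lemma dnear_seq Q (xs : nat -> path) x (C : R) :
  (\forall n \near \oo, Q (xs n)) -> (forall i, dist x (xs i) <= C * half i) ->
  xs n @[n --> \oo] --> near Q x.
Proof.
move=> Qxs dxs P [e /= e0 eP].
have ce : C * half n @[n --> \oo] --> (0 : R).
  by rewrite -(mulr0 C); apply: cvgM; [exact: cvg_cst|exact: cvg_half].
suff : \forall n \near \oo, P (xs n) by [].
apply: filterS2 Qxs (cvgr0_norm_lt _ ce _ e0) => n Qn ne; apply: eP.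
by split=> //; apply: le_lt_trans (le_lt_trans (ler_norm _) ne).
Qed.

Lemma Lambda_at_Lambda t z : Lambda_at T t z -> Lambda T t z.
Proof.
by move=> [/LambdaP[cz /andP[_ zT]] zt]; apply/LambdaP; rewrite zT -zt lexx.
Qed.

(** Increasing sequences of paths with summable roots of gauges converge, so the
abstract principle applies. The weights [2^-i] are summable, so the penalties
form a series of the kind allowed in a test functional. *)
Lemma path_variational t k (w : path -> R) z : 0 <= t -> Lambda_at T t z ->
  0 < k -> C0 T E (Lambda T t) w ->
  (forall y, Lambda T t y -> w y <= w z + k) ->
  exists (xs : nat -> path) x,
  [/\ xs 0%N = z, Lambda T t x,
      forall i, Lambda T t (xs i) /\ ptime (xs i) <= ptime x,
      forall i, gauge E x (xs i) <= k &
      forall y, Lambda T (ptime x) y ->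
        cvgn (series (fun i => half i * gauge E y (xs i))) ->
        w y - limn (series (fun i => half i * gauge E y (xs i))) <=
        w x - limn (series (fun i => half i * gauge E x (xs i)))].
Proof.
move=> t0 zt k0 cw wk; have [_ tz] := zt.
 pose L (y : path) : set path := Lambda T (ptime y).
have zL y : L z y <-> Lambda T t y by rewrite /L tz.
have Lz : Lambda T t z by exact: Lambda_at_Lambda zt.
pose D := 2 * Num.sqrt k.
pose to (xs : nat -> path) x := forall i, dist x (xs i) <= 4 * D * half i.
have L0 : L z z by apply/zL.
have L_refl x : L z x -> L x x.
  by move=> /LambdaP[cx /andP[_ xT]]; apply/LambdaP; rewrite lexx xT.
have L_trans x y y' : L x y -> L y y' -> L x y'.
  by move=> /LambdaP[_ /andP[xy _]]; exact: Lambda_le.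
have rho0 x y : L z x -> L x y -> 0 <= gauge E y x.
  by move=> /Lambda_cpath cx /Lambda_cpath cy; exact: gauge_ge0.
have rhoxx x : L z x -> gauge E x x = 0.
  by move=> /LambdaP[cx /andP[_ xT]]; exact: (gauge_refl (T := T)).
have compl (xs : nat -> path) : (forall i, L z (xs i)) ->
    (forall i, L (xs i) (xs i.+1)) ->
    (forall i, gauge E (xs i.+1) (xs i) <= k * half i * half i) ->
    exists x, (forall i, L (xs i) x) /\ to xs x.
  move=> zxs xsxs gxs.
  have cx i : cpath (xs i) by apply: Lambda_cpath (zxs i).
  have tt i : ptime (xs i) <= ptime (xs i.+1) <= T by have /LambdaP[] := xsxs i.
  have [|i|i|x [Lx xsx tox]] := @Lambda_complete R H T E T0 sgE cE t D xs t0.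
  - by move=> i; apply/zL.
  - by case/andP: (tt i).
  - have c0 : 0 <= Num.sqrt k * half i by rewrite mulr_ge0 ?sqrtr_ge0 ?half_ge0.
    have gc : gauge E (xs i.+1) (xs i) <= (Num.sqrt k * half i) ^+ 2.
      by rewrite exprMn sqr_sqrtr ?(ltW k0)// [half i ^+ 2]expr2 mulrA.
    by rewrite /D -mulrA; exact: gauge_dist_le.
  exists x; split=> // i; apply/LambdaP; rewrite xsx.
  by have /LambdaP[? /andP[_ ->]] := Lx.
have w_cvg (xs : nat -> path) x : (forall i, L z (xs i)) -> L z x -> to xs x ->
    w (xs n) @[n --> \oo] --> w x.
  move=> zxs /zL zx tox.
  apply: (cvg_comp _ _ (dnear_seq (Q := Lambda T t) _ tox)).
    by apply: nearW => n; apply/zL.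
  exact: C0_cvg.
have rho_cvg (xs : nat -> path) x i : (forall j, L z (xs j)) ->
    (forall j, L (xs j) (xs j.+1)) -> (forall j, L (xs j) x) -> to xs x ->
    gauge E (xs n) (xs i) @[n --> \oo] --> gauge E x (xs i).
  move=> zxs xsxs xsx tox.
  have xsi j : L (xs i) (xs (i + j)%N).
    elim: j => [|j ih]; first by rewrite addn0; exact: L_refl.
    by rewrite addnS; exact: L_trans ih (xsxs _).
  have ci : cpath (xs i) by exact: Lambda_cpath (zxs i).
  have i0 : 0 <= ptime (xs i) by case: ci.
  have ev : \forall n \near \oo, L (xs i) (xs n).
    by exists i => // n /= ni; rewrite -(subnKC ni); exact: xsi.
  apply: (cvg_comp xs (fun y => gauge E y (xs i)) (dnear_seq ev tox)).
  exact: (cvg_gauge T0 sgE cE i0 (xsx i) ci (lexx _)).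
have w_max x : L z x -> w x <= w z + k by move=> /zL; exact: wk.
have [xs [x [xs0 zxs xsx gx mx]]] := borwein_preiss L0 L_refl L_trans rho0 rhoxx
  compl w_cvg rho_cvg w_max k0.
exists xs, x; split=> //; first by apply/zL; rewrite -xs0.
move=> i; split; first by apply/zL.
by have /LambdaP[_ /andP[]] := xsx i.
Qed.

Lemma Lambda_hLambda t z : Lambda T t z -> hLambda T t z.
Proof.
move=> /LambdaP[cz tz]; have [z0 nz cpz] := cz; split=> //; split=> s sI.
  by apply: cvg_at_right_filter; exact: cpz.
by apply/cvg_ex; exists (z s); apply: cvg_at_left_filter; exact: cpz.
Qed.

Section test_functionals.
Variables (ip : {dot H for (@idfun R)}) (A : H -> H -> Prop).
Hypothesis ip_norm : forall x : H, `|x| ^+ 2 = ip x x.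

Lemma cvg_PhiTest t z f ft fx Afx : PhiTest T E ip A f ft fx Afx ->
  0 <= t -> Lambda T t z -> ptime z < T ->
  [/\ f z' @[z' --> near (Lambda T t) z] --> f z,
      ft z' @[z' --> near (Lambda T t) z] --> ft z,
      fx z' @[z' --> near (Lambda T t) z] --> fx z &
      ip (Afx z') (pend z') @[z' --> near (Lambda T t) z] -->
      ip (Afx z) (pend z)].
Proof.
move=> [[fh [[cf _ _ cft cfx] fE ftE fxE]] [_ cA]] t0 Lz zT.
have L0 : Lambda T t `<=` (Lambda T 0 : set path) by move=> y; exact: (Lambda_le t0).
have Lh : Lambda T t `<=` (hLambda T 0 : set path) by move=> y /L0; exact: Lambda_hLambda.
have inL := dnear_in T E (Lambda T t) z.
have early : \forall z' \near near (Lambda T t) z, ptime z' < T.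
  exact: (cvgr_lt _ (cvg_ptime T0 sgE cE Lz)).
split.
- rewrite (fE _ (L0 _ Lz)); apply: (cvg_trans (G := fh z' @[z' --> near (Lambda T t) z])).
    by apply: near_eq_cvg; apply: filterS inL => y /L0 Ly; rewrite fE.
  exact: (cvg_comp _ _ (dnear_sub Lh) (C0_cvg cf (Lh _ Lz))).
- rewrite (ftE _ (L0 _ Lz))//.
  apply: (cvg_trans (G := dt fh z' @[z' --> near (Lambda T t) z])).
    by apply: near_eq_cvg; apply: filterS2 inL early => y /L0 Ly yT; rewrite ftE.
  have sub : \forall z' \near near (Lambda T t) z, hLambda T 0 z' /\ ptime z' < T.
    by apply: filterS2 inL early => y /Lh.
  exact: (cvg_comp _ _ (dnear_sub_near sub) (C0_cvg cft (conj (Lh _ Lz) zT))).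
- rewrite (fxE _ (L0 _ Lz)).
  apply: (cvg_trans (G := dx ip fh z' @[z' --> near (Lambda T t) z])).
    by apply: near_eq_cvg; apply: filterS inL => y /L0 Ly; rewrite fxE.
  exact: (cvg_comp _ _ (dnear_sub Lh) (C0_cvg cfx (Lh _ Lz))).
- apply: (cvg_ip ip_norm); last exact: (cvg_pend T0 sgE cE Lz).
  exact: (cvg_comp _ _ (dnear_sub L0) (C0_cvg cA (L0 _ Lz))).
Qed.

(** The domination needed to exchange limits with the series of a test
functional. *)
Lemma near_gap_le t z (N : R) (ys : nat -> path) : 0 <= t -> Lambda T t z ->
  (forall i, [/\ Lambda T 0 (ys i), ptime (ys i) <= t & pnorm (ys i) <= N]) ->
  \forall z' \near near (Lambda T t) z, forall i,
    pnorm (gap E z' (ys i)) <= pnorm z + 1 + N /\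
    gauge E z' (ys i) <= 2 * (pnorm z + 1 + N) ^+ 2 + T ^+ 2.
Proof.
move=> t0 Lz ysP; have /LambdaP[cz /andP[tz zT]] := Lz.
apply: filterS2 (dnear_in T E (Lambda T t) z) (dnear_dist T E (Lambda T t) z ltr01).
move=> z' /LambdaP[cz' /andP[tz' zT']] dz' i.
have [/Lambda_cpath cy yt yN] := ysP i.
have z'z : pnorm z' <= pnorm z + 1.
  have := pnorm_lip T0 sgE cE cz cz' zT zT'; rewrite distrC => h.
  have := le_trans (ler_norm _) h; lra.
split.
  by apply: (le_trans (pnorm_gap_le sgE cE cz' cy)); rewrite lerD.
have yz' : ptime (ys i) <= ptime z' <= T by rewrite zT' (le_trans yt).
apply: (le_trans (gauge_ub T0 sgE cE cz' cy yz')); rewrite lerD2r ler_pM2l//.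
by apply: lerXn2r; rewrite ?nnegrE ?addr_ge0 ?pnorm_ge0 ?lerD// (le_trans _ yN) ?pnorm_ge0.
Qed.

Lemma gauge_series_cvg t z (N : R) (d : nat -> R) (ys : nat -> path) :
  0 <= t -> Lambda T t z -> (forall i, 0 <= d i) -> cvgn (series d) ->
  (forall i, [/\ Lambda T 0 (ys i), ptime (ys i) <= t & pnorm (ys i) <= N]) ->
  cvgn (series (fun i => d i * gauge E z (ys i))) /\
  limn (series (fun i => d i * gauge E z' (ys i)))
    @[z' --> near (Lambda T t) z] -->
  limn (series (fun i => d i * gauge E z (ys i))).
Proof.
move=> t0 Lz d0 cd ysP; have cz := Lambda_cpath Lz.
have nb := near_gap_le t0 Lz ysP.
have cy i : cpath (ys i) by have [/Lambda_cpath] := ysP i.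
pose C := 2 * (pnorm z + 1 + N) ^+ 2 + T ^+ 2.
have PF := dnear_proper T0 sgE cE Lz cz.
split.
  apply: (@is_cvg_weighted _ R^o d d0 cd _ C) => i.
  have [e /= e0 /(_ z)] := nb; rewrite /= dinf_refl// => /(_ (conj Lz e0) i)[_].
  by rewrite ger0_norm// gauge_ge0.
apply: (@cvg_weighted _ R^o d d0 cd _ _ PF (fun i z' => gauge E z' (ys i))
  (fun i => gauge E z (ys i)) C).
  apply: filterS2 nb (dnear_in _ _ _ _) => z' h /Lambda_cpath cz' i.
  by have [_] := h i; rewrite /= ger0_norm// gauge_ge0.
by move=> i; apply: cvg_gauge => //; have [] := ysP i.
Qed.

Lemma GTest_summable t g a : GTest T E t g a ->
  (forall i, 0 < gdelta a i) /\ cvgn (series (gdelta a)).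
Proof.
move=> [_ _ _ [N [_ d0 _ dN]] _]; split=> //.
have d0' i := ltW (d0 i).
exact: (is_cvg_nnseries d0' (iffLR (nneseries_leP _ d0') dN)).
Qed.

(** Only paths are inserted in [h], and their times stay in the strip where [h]
is continuous. *)
Lemma cvg_strip t z (h : R -> R -> R) : 0 <= t -> Lambda T t z ->
  {within `[0, T] `*` setT, continuous (fun z : R * R => h z.1 z.2)} ->
  h (ptime z') (Upsilon2 z') @[z' --> near (Lambda T t) z] -->
  h (ptime z) (Upsilon2 z).
Proof.
move=> t0 Lz /subspace_continuousP /(_ (ptime z, Upsilon2 z)) hc.
have time z' : Lambda T t z' -> 0 <= ptime z' <= T.
  by move=> /LambdaP[[z0 _ _] /andP[_ ->]]; rewrite z0.
have {}hc := hc (conj (time z Lz) I).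
have cU : Upsilon2 z' @[z' --> near (Lambda T t) z] --> Upsilon2 z.
  have cz := Lambda_cpath Lz; have c0 := @cpath_null R H.
  have := cvg_Upsilon2_gap T0 sgE cE Lz c0 t0; rewrite gap_null//; apply: cvg_trans.
  apply: near_eq_cvg; apply: filterS (dnear_in _ _ _ _) => z' /Lambda_cpath cz'.
  by rewrite gap_null.
apply: (cvg_comp (fun z' : path => (ptime z', Upsilon2 z'))
  (fun u : R * R => h u.1 u.2) _ hc) => P nP.
suff : \forall z' \near near (Lambda T t) z, P (ptime z', Upsilon2 z') by [].
have h' : \forall z' \near near (Lambda T t) z,
    (`[0, T] `*` setT) (ptime z', Upsilon2 z') -> P (ptime z', Upsilon2 z').
  exact: (cvg_pair (cvg_ptime T0 sgE cE Lz) cU nP).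
apply: filterS2 (dnear_in T E (Lambda T t) z) h' => z' Lz'; apply.
by split=> //=; rewrite in_itv /=; exact: time.
Qed.

Lemma cvg_g_dt t z g a : 0 <= t -> Lambda T t z -> GTest T E t g a ->
  g_dt a z' @[z' --> near (Lambda T t) z] --> g_dt a z.
Proof.
move=> t0 Lz ga; have [d0 cd] := GTest_summable ga.
have [_ [_ _ _ cht _] _ [N [_ _ pN _]] _] := ga.
apply: cvgD; first exact: cvg_strip cht.
apply: cvgM; first exact: cvg_cst.
apply: (@cvg_weighted _ R^o _ (fun i => ltW (d0 i)) cd _ _
  (dnear_proper T0 sgE cE Lz (Lambda_cpath Lz))
  (fun i z' => ptime z' - ptime (gpath a i)) (fun i => ptime z - ptime (gpath a i)) T).
  apply: filterS (dnear_in _ _ _ _) => z' /LambdaP[_ /andP[tz zT]] i.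
  have [/LambdaP[[p0 _ _] _] pt _] := pN i; rewrite /= ger0_norm; lra.
by move=> i; apply: cvgB; [exact: cvg_ptime|exact: cvg_cst].
Qed.

Lemma cvg_g_dx t z g a : 0 <= t -> Lambda T t z -> GTest T E t g a ->
  g_dx E ip a z' @[z' --> near (Lambda T t) z] --> g_dx E ip a z.
Proof.
move=> t0 Lz ga; have [d0 cd] := GTest_summable ga.
have [_ [_ _ _ _ chx] _ [N [_ _ pN _]] _] := ga.
have cz := Lambda_cpath Lz; have c0 := @cpath_null R H.
apply: cvgD.
  apply: cvgZ; first exact: cvg_strip chx.
  have := cvg_dx_Upsilon2_gap T0 sgE cE Lz c0 t0 ip_norm.
  rewrite gap_null//; apply: cvg_trans.
  apply: near_eq_cvg; apply: filterS (dnear_in _ _ _ _) => z' /Lambda_cpath cz'.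
  by rewrite gap_null.
apply: (@cvg_weighted _ H _ (fun i => ltW (d0 i)) cd _ _
  (dnear_proper T0 sgE cE Lz cz)
  (fun i z' => dx ip Upsilon2 (gap E z' (gpath a i)))
  (fun i => dx ip Upsilon2 (gap E z (gpath a i))) (4 * (pnorm z + 1 + N))).
  apply: filterS2 (near_gap_le t0 Lz pN) (dnear_in _ _ _ _).
  move=> z' h /Lambda_cpath cz' i; have [/Lambda_cpath cp _ _] := pN i.
  apply: (le_trans (dx_Upsilon2_le ip_norm (cpath_gap sgE cE cz' cp))).
  by rewrite ler_pM2l//; have [] := h i.
move=> i; have [/Lambda_cpath cp pt _] := pN i.
exact: cvg_dx_Upsilon2_gap.
Qed.

End test_functionals.
End perturbation.

Section perturbed_test.
Context {R : realType} {H : completeNormedModType R}.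
Local Notation path := (hpath H).
Implicit Types (z y x : path) (t s : R) (Q : set path).
Variables (T : R) (E : R -> H -> H).
Hypotheses (T0 : 0 <= T) (sgE : C0_semigroup E) (cE : contraction_semigroup E).
Local Notation half n := ((2^-1 : R) ^+ n).
Local Notation dist := (dinf T E).
Local Notation near := (dnear T E).

(** The constant [c] brings the maximal value back to 0; it does not affect the
derivatives. *)
Definition perturb (a : @gdata R H) (xs : nat -> path) (c : R) : @gdata R H :=
  GData (fun r u => gh a r u - c) (ght a) (ghx a)
    (interleave (gdelta a) (fun i => half i)) (interleave (gpath a) xs).

Let chalf : cvgn (series (fun i => half i)) := cvgP _ (@cvg_series_half R).

Lemma GTest_perturb t g (a : @gdata R H) (xs : nat -> path) x (N c : R) :
  0 <= t -> GTest T E t g a -> Lambda T t x ->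
  (forall i, [/\ Lambda T t (xs i), ptime (xs i) <= ptime x &
                 pnorm (xs i) <= N]) ->
  GTest T E (ptime x)
    (fun z => g z + limn (series (fun i => half i * gauge E z (xs i))) - c)
    (perturb a xs c).
Proof.
move=> t0 ga Lx xsP; have [dpos cd] := GTest_summable ga.
have [cg [sh sht shc sct schx] hx0 [N' [N'0 _ pN dN]] gE] := ga.
have /LambdaP[cx /andP[tx xT]] := Lx; have tx0 := le_trans t0 tx.
have Lxt : Lambda T (ptime x) `<=` (Lambda T t : set path).
  by move=> y; exact: Lambda_le.
have xsP0 i : [/\ Lambda T 0 (xs i), ptime (xs i) <= ptime x & pnorm (xs i) <= N].
  by have [? ? ?] := xsP i; split=> //; exact: Lambda_le t0 _.
have pN0 i : [/\ Lambda T 0 (gpath a i), ptime (gpath a i) <= ptime x &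
    pnorm (gpath a i) <= N'].
  by have [? h ?] := pN i; split=> //; exact: le_trans tx.
have d0 i := ltW (dpos i).
split.
- apply: cvg_C0 => z Lz; apply: cvgB; last exact: cvg_cst.
  apply: cvgD.
    exact: (cvg_comp _ _ (dnear_sub Lxt) (C0_cvg cg (Lxt _ Lz))).
  have [_] := gauge_series_cvg T0 sgE cE tx0 Lz half_ge0 chalf xsP0; exact.
- split; [| | |exact: sct|exact: schx].
  + move=> s y sT /=; have := sh s y sT; apply: cvg_trans; apply: near_eq_cvg.
    by apply: nearW => r; rewrite opprB addrA subrK.
  + move=> s y sT /=; have := sht s y sT => dh.
    rewrite -[ghx a s y]subr0; exact: (is_deriveB dh (is_derive_cst c y 1)).
  + move=> u; apply: cvgB; [exact: shc|exact: cvg_cst].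
- exact: hx0.
- exists (N' + 2 + Num.max N 0); split.
  + by rewrite !ltr_wpDr// le_max lexx orbT.
  + by apply: (interleave_all (P := fun r => 0 < r)) => // i; exact: half_gt0.
  + apply: (interleave_all (P := fun p => [/\ Lambda T 0 p,
      ptime p <= ptime x & pnorm p <= N' + 2 + Num.max N 0])) => i.
      have [? ? h] := pN0 i; split=> //; apply: (le_trans h).
      by rewrite -addrA lerDl addr_ge0// le_max lexx orbT.
    have [? ? h] := xsP0 i; split=> //; apply: (le_trans h).
    rewrite (@le_trans _ _ (Num.max N 0)) ?le_max ?lexx// lerDr.
    by rewrite addr_ge0// ltW.
  + apply/nneseries_leP.
      by apply: (interleave_all (P := fun r => 0 <= r)) => // i; exact: half_ge0.
    move=> n; rewrite series_interleave; apply: (@le_trans _ _ (N' + 2)).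
      apply: lerD; first by move: (uphalf n); exact/nneseries_leP.
      by rewrite series_half lerBlDr lerDl mulr_ge0 ?half_ge0.
    by rewrite lerDl le_max lexx orbT.
- move=> z Lz; rewrite (gE _ (Lxt _ Lz)) /=.
  have [co _] := gauge_series_cvg T0 sgE cE tx0 Lz d0 cd pN0.
  have [cn _] := gauge_series_cvg T0 sgE cE tx0 Lz half_ge0 chalf xsP0.
  rewrite -/(gauge E z _).
  have -> : (fun i => interleave (gdelta a) (fun i => half i) i *
      (Upsilon2 (psub z (pextendA E (interleave (gpath a) xs i) (ptime z))) +
      `|ptime z - ptime (interleave (gpath a) xs i)| ^+ 2)) =
    interleave (fun i => gdelta a i * gauge E z (gpath a i))
      (fun i => half i * gauge E z (xs i)).
    by apply/funext => i; rewrite /interleave; case: ifP.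
  rewrite (cvg_lim _ (cvg_series_interleave co cn))//.
  rewrite /gauge /gap; lra.
Qed.

Lemma g_dt_perturb t g (a : @gdata R H) (xs : nat -> path) x (N k c : R) :
  0 <= t -> GTest T E t g a -> Lambda T t x -> 0 <= k ->
  (forall i, [/\ Lambda T t (xs i), ptime (xs i) <= ptime x &
                 pnorm (xs i) <= N]) ->
  (forall i, `|ptime x - ptime (xs i)| <= k) ->
  `|g_dt (perturb a xs c) x - g_dt a x| <= 4 * k.
Proof.
move=> t0 ga Lx k0 xsP xk; have [dpos cd] := GTest_summable ga.
have [_ _ _ [N' [_ _ pN _]] _] := ga.
have d0 i := ltW (dpos i); have /LambdaP[_ /andP[tx xT]] := Lx.
have co : cvgn (series (fun i => gdelta a i * (ptime x - ptime (gpath a i)))).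
  apply: (@is_cvg_weighted _ R^o _ d0 cd _ T) => i.
  have [/LambdaP[[p0 _ _] _] pt _] := pN i; rewrite /= ger0_norm; lra.
have cn : cvgn (series (fun i => half i * (ptime x - ptime (xs i)))).
  exact: (@is_cvg_weighted _ R^o _ half_ge0 chalf _ k).
rewrite /g_dt /=.
have -> : (fun i => interleave (gdelta a) (fun i => half i) i *
    (ptime x - ptime (interleave (gpath a) xs i))) =
  interleave (fun i => gdelta a i * (ptime x - ptime (gpath a i)))
    (fun i => half i * (ptime x - ptime (xs i))).
  by apply/funext => i; rewrite /interleave; case: ifP.
rewrite (cvg_lim _ (cvg_series_interleave co cn))//.
rewrite mulrDr opprD addrACA subrr add0r addrAC subrr add0r normrM ger0_norm//.
have := @weighted_le _ R^o _ half_ge0 chalf (fun i => ptime x - ptime (xs i)) k xk.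
rewrite (cvg_lim _ (@cvg_series_half R))//= => h.
have -> : 4 * k = 2 * (k * 2) by ring.
by rewrite ler_pM2l.
Qed.

Variable ip : {dot H for (@idfun R)}.
Hypothesis ip_norm : forall x : H, `|x| ^+ 2 = ip x x.

Lemma g_dx_perturb t g (a : @gdata R H) (xs : nat -> path) x (N k c : R) :
  0 <= t -> GTest T E t g a -> Lambda T t x -> 0 <= k ->
  (forall i, [/\ Lambda T t (xs i), ptime (xs i) <= ptime x &
                 pnorm (xs i) <= N]) ->
  (forall i, pnorm (gap E x (xs i)) <= k) ->
  `|g_dx E ip (perturb a xs c) x - g_dx E ip a x| <= 8 * k.
Proof.
move=> t0 ga Lx k0 xsP xk; have [dpos cd] := GTest_summable ga.
have [_ _ _ [N' [_ _ pN _]] _] := ga.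
have d0 i := ltW (dpos i); have /LambdaP[cx /andP[tx xT]] := Lx.
have co : cvgn (series (fun i => gdelta a i *: dx ip Upsilon2 (gap E x (gpath a i)))).
  apply: (@is_cvg_weighted _ H _ d0 cd _ (4 * (pnorm x + N'))) => i.
  have [/Lambda_cpath cp _ h] := pN i.
  apply: (le_trans (dx_Upsilon2_le ip_norm (cpath_gap sgE cE cx cp))).
  rewrite ler_pM2l// (le_trans (pnorm_gap_le sgE cE cx cp))// lerD2l//.
have b4 i : `|dx ip Upsilon2 (gap E x (xs i))| <= 4 * k.
  have [/Lambda_cpath cp _ h] := xsP i.
  apply: (le_trans (dx_Upsilon2_le ip_norm (cpath_gap sgE cE cx cp))).
  by rewrite ler_pM2l.
have cn : cvgn (series (fun i => half i *: dx ip Upsilon2 (gap E x (xs i)))).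
  exact: (@is_cvg_weighted _ H _ half_ge0 chalf _ (4 * k)).
rewrite /g_dx /=.
have -> : (fun i => interleave (gdelta a) (fun i => half i) i *:
    dx ip Upsilon2 (psub x (pextendA E (interleave (gpath a) xs i) (ptime x)))) =
  interleave (fun i => gdelta a i *: dx ip Upsilon2 (gap E x (gpath a i)))
    (fun i => half i *: dx ip Upsilon2 (gap E x (xs i))).
  by apply/funext => i; rewrite /interleave; case: ifP.
rewrite (cvg_lim _ (cvg_series_interleave co cn))//.
rewrite opprD addrACA subrr add0r addrAC subrr add0r.
have := @weighted_le _ H _ half_ge0 chalf _ _ b4.
rewrite (cvg_lim _ (@cvg_series_half R))//= => /le_trans; apply; lra.
Qed.

End perturbed_test.

Section stability.
Context {R : realType} {H : completeNormedModType R}.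
Local Notation path := (hpath H).
Implicit Types (z y x : path) (t s : R) (Q : set path).
Variables (T : R) (E : R -> H -> H).
Hypotheses (T0 : 0 <= T) (sgE : C0_semigroup E) (cE : contraction_semigroup E).
Variables (ip : {dot H for (@idfun R)}) (A : H -> H -> Prop).
Hypothesis ip_norm : forall x : H, `|x| ^+ 2 = ip x x.
Local Notation half n := ((2^-1 : R) ^+ n).
Local Notation dist := (dinf T E).
Local Notation near := (dnear T E).

Lemma C0_subset {V : normedModType R} Q Q' (f : path -> V) :
  Q' `<=` Q -> C0 T E Q f -> C0 T E Q' f.
Proof.
move=> QQ cf z /QQ Qz e /(cf z Qz)[d d0 fd]; exists d => // z' /QQ.
exact: fd.
Qed.

Lemma PhiTest_C0 f ft fx Afx : PhiTest T E ip A f ft fx Afx ->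
  C0 T E (Lambda T 0) f.
Proof.
move=> [[fh [[cf _ _ _ _] fE _ _]] _] z Lz e /(cf _ (Lambda_hLambda Lz))[d d0 fd].
by exists d => // z' Lz' dz'; rewrite !fE//; apply: fd => //; exact: Lambda_hLambda.
Qed.

(** A maximum point of the limit problem is almost maximal for the approximate
one, hence close to a true maximum point after a perturbation of the test
functional which stays in the same class; the data of the equation at the two
points are close. *)
Lemma perturbed_test t z w f ft fx Afx g a :
  0 <= t < T -> Lambda_at T t z ->
  PhiTest T E ip A f ft fx Afx -> GTest T E t g a ->
  (forall y, Lambda T t y -> w y - f y - g y <= w z - f z - g z) ->
  forall e : R, 0 < e -> exists2 d : R, 0 < d &
  forall w', C0 T E (Lambda T 0) w' ->
  (forall y, Lambda T 0 y -> `|w' y - w y| <= d) ->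
  exists x g' a',
  [/\ Lambda_at T (ptime x) x, 0 <= ptime x < T & GTest T E (ptime x) g' a'] /\
  [/\ w' x - f x - g' x = 0,
      forall y, Lambda T (ptime x) y -> w' y - f y - g' y <= 0,
      dist z x <= e,
      `|(ft x + g_dt a' x + ip (Afx x) (pend x)) -
        (ft z + g_dt a z + ip (Afx z) (pend z))| <= e &
      `|(fx x + g_dx E ip a' x) - (fx z + g_dx E ip a z)| <= e].
Proof.
move=> /andP[t0 tT] zt hf ga zmax e e0.
have Lz := Lambda_at_Lambda zt; have [_ tz] := zt.
have cz := Lambda_cpath Lz; have zT : ptime z < T by rewrite tz.
have Lt0 : Lambda T t `<=` (Lambda T 0 : set path) by move=> y; exact: (Lambda_le t0).
have [_ cft cfx cip] := cvg_PhiTest T0 sgE cE ip_norm hf t0 Lz zT.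
have e20 : 0 < e / 2 by rewrite divr_gt0.
have n1 : \forall x \near near (Lambda T t) z,
    `|(ft x + g_dt a x + ip (Afx x) (pend x)) -
      (ft z + g_dt a z + ip (Afx z) (pend z))| <= e / 2.
  apply: (cvgr_distC_le _ _ (cvgD (cvgD cft _) cip) _ e20).
  exact: cvg_g_dt ga.
have n2 : \forall x \near near (Lambda T t) z,
    `|(fx x + g_dx E ip a x) - (fx z + g_dx E ip a z)| <= e / 2.
  apply: (cvgr_distC_le _ _ (cvgD cfx _) _ e20).
  exact: cvg_g_dx ga.
have n3 : \forall x \near near (Lambda T t) z, ptime x < T.
  exact: (cvgr_lt _ (cvg_ptime T0 sgE cE Lz)).
have [r /= r0 rP] : (near (Lambda T t) z) _ := filterI (filterI n1 n2) n3.
(* A gauge at most [s ^+ 2] gives distances at most [2 * s] and changes of the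
   derivatives at most [8 * s]. *)
pose s := Num.min r e / 16; have re0 : 0 < Num.min r e by rewrite lt_min r0.
have s0 : 0 < s by rewrite divr_gt0.
have sr : 2 * s < r.
  have : Num.min r e <= r by rewrite ge_min lexx.
  rewrite /s; lra.
have se : 16 * s <= e.
  have : Num.min r e <= e by rewrite ge_min lexx orbT.
  rewrite /s; lra.
have k0 : 0 < s ^+ 2 by rewrite exprn_gt0.
exists (s ^+ 2 / 2); first by rewrite divr_gt0.
move=> w' cw' w'w.
pose v y := w' y - f y - g y.
have cv : C0 T E (Lambda T t) v.
  have [cg _ _ _ _] := ga.
  apply: cvg_C0 => y Ly; apply: cvgB; last exact: C0_cvg.
  apply: cvgB; apply: C0_cvg => //.
    exact: C0_subset cw'.
  exact: C0_subset (PhiTest_C0 hf).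
have vmax y : Lambda T t y -> v y <= v z + s ^+ 2.
  move=> Ly; have := w'w _ (Lt0 _ Ly); have := w'w _ (Lt0 _ Lz); have := zmax _ Ly.
  rewrite !ler_norml /v => h0 /andP[h1 h2] /andP[h3 h4]; lra.
have [xs [x [xs0 Lx xsP gx xmax]]] := path_variational T0 sgE cE t0 zt k0 cv vmax.
have /LambdaP[cx /andP[tx xT]] := Lx; have tx0 := le_trans t0 tx.
have cxs i : cpath (xs i) by have [/Lambda_cpath] := xsP i.
have xsx i : ptime (xs i) <= ptime x <= T by rewrite xT andbT; have [] := xsP i.
have gxs i := gauge_le sgE cE cx (cxs i) (ltW s0) (gx i).
have dxs i : dist x (xs i) <= 2 * s.
  exact: gauge_dist_le (ltW s0) (xsx i) (gx i).
have dzx : dist z x <= 2 * s by rewrite dinf_sym// -xs0.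
have xsN i : [/\ Lambda T t (xs i), ptime (xs i) <= ptime x &
    pnorm (xs i) <= pnorm x + 2 * s].
  have [Li lei] := xsP i; split=> //.
  have := pnorm_lip T0 sgE cE cx (cxs i) xT (le_trans lei xT).
  have := dxs i; rewrite ler_norml => h1 /andP[h2 h3]; lra.
have xsN0 i : [/\ Lambda T 0 (xs i), ptime (xs i) <= ptime x &
    pnorm (xs i) <= pnorm x + 2 * s].
  by have [/Lt0 ? ? ?] := xsN i.
pose S (y : path) : R := limn (series (fun i => half i * gauge E y (xs i))).
pose c := S x - v x.
have [[/= h1 h2] h3] := rP x (conj Lx (le_lt_trans dzx sr)).
have t1 : `|g_dt (perturb a xs c) x - g_dt a x| <= 4 * s.
  apply: g_dt_perturb ga Lx (ltW s0) xsN _ => // i; exact: (gxs i).2.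
have t2 : `|g_dx E ip (perturb a xs c) x - g_dx E ip a x| <= 8 * s.
  apply: g_dx_perturb ga Lx (ltW s0) xsN _ => // i; exact: (gxs i).1.
exists x, (fun y => g y + S y - c), (perturb a xs c); split; split.
- by split=> //; apply: Lt0.
- by rewrite tx0.
- exact: GTest_perturb ga Lx xsN.
- by rewrite /c /v /=; ring.
- move=> y Ly; have cc : cvgn (series (fun i => half i * gauge E y (xs i))).
    have := gauge_series_cvg T0 sgE cE tx0 Ly half_ge0 (cvgP _ (@cvg_series_half R)) xsN0.
    by case.
  have := xmax y Ly cc; rewrite -/(S y) -/(S x) /c /v /=; lra.
- lra.
- set X := _ - _; have -> : X =
    (ft x + g_dt a x + ip (Afx x) (pend x) -
     (ft z + g_dt a z + ip (Afx z) (pend z))) +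
    (g_dt (perturb a xs c) x - g_dt a x) by rewrite /X; ring.
  by rewrite (le_trans (ler_normD _ _))//; lra.
- set X := _ - _; have -> : X =
    (fx x + g_dx E ip a x - (fx z + g_dx E ip a z)) +
    (g_dx E ip (perturb a xs c) x - g_dx E ip a x).
    apply/esym; rewrite addrC addrA [fx x + g_dx E ip a x]addrC subrKA.
    by rewrite /X [fx x + _]addrC.
  by rewrite (le_trans (ler_normD _ _))//; lra.
Qed.

Context {U : metricType R}.
Implicit Types (F : path -> U -> H) (q : path -> U -> R).

Lemma Hamiltonian_le_val F q z (p : H) u :
  (Hamiltonian ip F q z p <= (ip p (F z u) + q z u)%:E)%E.
Proof. by apply: ereal_inf_lbound; exists u. Qed.

Lemma le_Hamiltonian F q z (p : H) (c : R) :
  (c%:E <= Hamiltonian ip F q z p)%E <-> forall u, c <= ip p (F z u) + q z u.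
Proof.
split=> [h u|h].
  by rewrite -lee_fin; exact: le_trans h (Hamiltonian_le_val _ _ _ _ _).
by apply: le_ereal_inf_tmp => _ [u _ <-]; rewrite lee_fin.
Qed.

Lemma sub_HamiltonianP F q z (p : H) (c : R) :
  (0 <= c%:E + Hamiltonian ip F q z p)%E <->
  forall u, 0 <= c + (ip p (F z u) + q z u).
Proof.
rewrite -leeBlDl// add0e -EFinN le_Hamiltonian.
by split=> h u; have := h u; lra.
Qed.

(** The infimum need not be attained, hence the slack [e]. *)
Lemma super_HamiltonianP F q z (p : H) (c : R) :
  (c%:E + Hamiltonian ip F q z p <= 0)%E <->
  forall e, 0 < e -> exists u, c + (ip p (F z u) + q z u) <= e.
Proof.
rewrite -leeBrDl// add0e -EFinN; split=> [h e e0|h].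
  apply: contrapT => /forallNP no.
  have : ((e - c)%:E <= Hamiltonian ip F q z p)%E.
    apply/le_Hamiltonian => u; have /negP := no u; rewrite -ltNge => ?; lra.
  by move=> /le_trans/(_ h); rewrite lee_fin; lra.
apply/lee_addgt0Pr => e /h[u ue].
apply: (le_trans (Hamiltonian_le_val _ _ _ _ u)).
by rewrite -EFinD lee_fin; lra.
Qed.

(** The difference of the integrands is [(p' - p, F') + (p, F' - F) + (q' - q)];
as [F] is bounded at [z] and Lipschitz in the path, uniformly in the control, so
is the estimate. *)
Lemma Hamiltonian_close F q phi z (p : H) (e : R) :
  data_hypothesis T E F q phi -> Lambda T 0 z -> 0 < e ->
  exists2 d : R, 0 < d <= e &
  forall F' q' x p', Lambda T 0 x -> dist z x <= d -> `|p' - p| <= d ->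
  (forall u, `|F' x u - F x u| <= d /\ `|q' x u - q x u| <= d) ->
  forall u, `|(ip p' (F' x u) + q' x u) - (ip p (F z u) + q z u)| <= e.
Proof.
move=> [_ _ [L L0 [lip _]]] Lz e0.
pose M := 1 + L ^+ 2 * (1 + pnorm z ^+ 2).
have FM u : `|F z u| <= M.
  have [+ _ _ _] := lip z z u Lz Lz; rewrite /M.
  have := sqr_ge0 (`|F z u| - 1); rewrite sqrrB expr1n mulr1; nra.
have M0 : 0 <= M.
  by rewrite /M addr_ge0// mulr_ge0 ?sqr_ge0// addr_ge0 ?sqr_ge0.
pose K := M + 1 + `|p| + 1; have K1 : 1 <= K by rewrite /K; have := normr_ge0 p; lra.
pose b := Num.min 1 (e / K); have b0 : 0 < b.
  by rewrite lt_min ltr01 divr_gt0//; lra.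
have b1 : b <= 1 by rewrite ge_min lexx.
have bK : b * K <= e.
  by rewrite -ler_pdivlMr ?ge_min ?lexx ?orbT//; lra.
have be : b <= e by apply: (le_trans _ bK); rewrite ler_peMr// ltW.
have L10 : 0 < 1 + L by lra.
exists (b / (1 + L)).
  by rewrite divr_gt0//= (le_trans _ be)// ler_pdivrMr// ler_peMr ?(ltW b0)//; lra.
set d := b / (1 + L) => F' q' x p' Lx dzx pp FF u.
have db : d * (1 + L) = b by rewrite /d divfK// gt_eqF.
have d0 : 0 <= d by rewrite /d divr_ge0 ?ltW.
have dleb : d <= b by rewrite -db ler_peMr//; lra.
have cz := Lambda_cpath Lz; have cx := Lambda_cpath Lx.
have Ldist : L * dist z x <= L * d by rewrite ler_pM2l.
have [FF1 FF2] := FF u; have [_ l1 l2 _] := lip z x u Lz Lx.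
have F'b : `|F' x u - F z u| <= b.
  rewrite -(subrKA (F x u)) (le_trans (ler_normD _ _))//.
  by rewrite -db; rewrite distrC in l1; lra.
have q'b : `|q' x u - q z u| <= b.
  rewrite -(subrKA (q x u)) (le_trans (ler_normD _ _))//.
  by rewrite -db; rewrite distrC in l2; lra.
have F'M : `|F' x u| <= M + 1.
  rewrite -(subrK (F z u) (F' x u)) (le_trans (ler_normD _ _))// addrC.
  by have := FM u; lra.
have -> : ip p' (F' x u) + q' x u - (ip p (F z u) + q z u) =
    ip (p' - p) (F' x u) + ip p (F' x u - F z u) + (q' x u - q z u).
  by rewrite ipBl ipBr; ring.
rewrite (le_trans (ler_normD _ _))// (le_trans (lerD (ler_normD _ _) (lexx _)))//.
have h1 : `|ip (p' - p) (F' x u)| <= b * (M + 1).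
  rewrite (le_trans (normr_ip_le ip_norm _ _))// ler_pM//.
  exact: le_trans dleb.
have h2 : `|ip p (F' x u - F z u)| <= `|p| * b.
  by rewrite (le_trans (normr_ip_le ip_norm _ _))// ler_wpM2l.
apply: le_trans bK; rewrite /K; lra.
Qed.

End stability.

(** * Stability *)

Section uniform_convergence.
Context {R : realType} {H : completeNormedModType R}.
Variables (T : R) (U : Type).
Hypothesis T0 : 0 <= T.
Local Notation path := (hpath H).

(** The supremum over an empty set of controls would be -oo, so the convergence
to 0 also provides a control, which is needed to speak of the other data. *)
Lemma uniform_close (F : path -> U -> H) (q : path -> U -> R)
    (phi v : path -> R) (Fe : R -> path -> U -> H) (qe : R -> path -> U -> R)
    (phie ve : R -> path -> R) :
  ereal_sup [set ereal_sup
      [set (`|Fe eps x.1 x.2 - F x.1 x.2| + `|qe eps x.1 x.2 - q x.1 x.2|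
            + `|phie eps y - phi y| + `|ve eps x.1 - v x.1|)%:E
        | y in Lambda_at T T]
      | x in Lambda T 0 `*` [set: U]] @[eps --> 0^'+] --> (0 : \bar R)%E ->
  forall d : R, 0 < d -> exists eps : R, [/\ 0 < eps,
    forall y, Lambda T 0 y -> `|ve eps y - v y| <= d,
    forall y, Lambda_at T T y -> `|phie eps y - phi y| <= d &
    forall y u, Lambda T 0 y ->
      `|Fe eps y u - F y u| <= d /\ `|qe eps y u - q y u| <= d].
Proof.
move=> hcvg d d0.
have lt0d : (0 < d%:E)%E by rewrite lte_fin.
have lt10 : ((-1)%:E < 0 :> \bar R)%E by rewrite lte_fin ltrN10.
have n1 := hcvg _ (open_ereal_lt' lt0d); have n2 := hcvg _ (open_ereal_gt' lt10).
have [eps [eps0 h1 h2]] : exists eps : R, [/\ 0 < eps,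
    (ereal_sup [set ereal_sup
      [set (`|Fe eps x.1 x.2 - F x.1 x.2| + `|qe eps x.1 x.2 - q x.1 x.2|
            + `|phie eps y - phi y| + `|ve eps x.1 - v x.1|)%:E
        | y in Lambda_at T T]
      | x in Lambda T 0 `*` [set: U]] < d%:E)%E &
    ((-1)%:E < ereal_sup [set ereal_sup
      [set (`|Fe eps x.1 x.2 - F x.1 x.2| + `|qe eps x.1 x.2 - q x.1 x.2|
            + `|phie eps y - phi y| + `|ve eps x.1 - v x.1|)%:E
        | y in Lambda_at T T]
      | x in Lambda T 0 `*` [set: U]])%E].
  near (0 : R)^'+ => eps; exists eps; split=> //; near: eps; [exact: n1|exact: n2].
have [u0 _] : exists u0 : U, True.
  apply: contrapT => /forallNP noU; move: h2; rewrite ltNge => /negP; apply.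
  by apply: ge_ereal_sup => r [[x u] _ _]; have := noU u I.
have all y u y' : Lambda T 0 y -> Lambda_at T T y' ->
    `|Fe eps y u - F y u| + `|qe eps y u - q y u| + `|phie eps y' - phi y'| +
    `|ve eps y - v y| <= d.
  move=> Ly Ly'; rewrite -lee_fin; apply: (le_trans _ (ltW h1)).
  apply: (@le_trans _ _ (ereal_sup
      [set (`|Fe eps y u - F y u| + `|qe eps y u - q y u|
            + `|phie eps y0 - phi y0| + `|ve eps y - v y|)%:E
        | y0 in Lambda_at T T])).
    by apply: ereal_sup_ubound; exists y'.
  by apply: ereal_sup_ubound; exists (y, u) => //; split.
have [yT LyT] : exists y : path, Lambda_at T T y.
  exists (Path T (fun=> 0)); split=> //; apply/LambdaP; rewrite /= T0 lexx.
  by split=> //; split=> // s; exact: cvg_cst.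
exists eps; split=> // [y Ly|y Ly|y u Ly].
- have := all y u0 yT Ly LyT; have := normr_ge0 (Fe eps y u0 - F y u0).
  have := normr_ge0 (qe eps y u0 - q y u0); have := normr_ge0 (phie eps yT - phi yT).
  lra.
- have [Ly0 _] := Ly.
  have := all y u0 y Ly0 Ly; have := normr_ge0 (Fe eps y u0 - F y u0).
  have := normr_ge0 (qe eps y u0 - q y u0); have := normr_ge0 (ve eps y - v y).
  lra.
- have := all y u yT Ly LyT; have := normr_ge0 (Fe eps y u - F y u).
  have := normr_ge0 (qe eps y u - q y u); have := normr_ge0 (phie eps yT - phi yT).
  have := normr_ge0 (ve eps y - v y); split; lra.
Unshelve. all: by end_near. Qed.

End uniform_convergence.

Theorem theorem3p3 (R : realType) (H : completeNormedModType R)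
    (ip : {dot H for (@idfun R)}) (hH : separable_hilbert ip)
    (T : R) (hT : 0 < T)
    (A : H -> H -> Prop) (E : R -> H -> H) (hA : generates A E)
    (U : metricType R)
    (F : hpath H -> U -> H) (q : hpath H -> U -> R) (phi : hpath H -> R)
    (hyp : data_hypothesis T E F q phi)
    (v : hpath H -> R) (hv : C0 T E (Lambda T 0) v)
    (Fe : R -> hpath H -> U -> H) (qe : R -> hpath H -> U -> R)
    (phie : R -> hpath H -> R) (ve : R -> hpath H -> R)
    (hype : forall eps : R, 0 < eps ->
      data_hypothesis T E (Fe eps) (qe eps) (phie eps))
    (hve : forall eps : R, 0 < eps -> C0 T E (Lambda T 0) (ve eps))
    (hcvg : ereal_sup [set ereal_sup
        [set (`|Fe eps x.1 x.2 - F x.1 x.2| + `|qe eps x.1 x.2 - q x.1 x.2|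
              + `|phie eps y - phi y| + `|ve eps x.1 - v x.1|)%:E
          | y in Lambda_at T T]
        | x in Lambda T 0 `*` [set: U]] @[eps --> 0^'+] --> (0 : \bar R)%E) :
  ((forall eps : R, 0 < eps ->
      viscosity_subsolution T E ip A (Fe eps) (qe eps) (phie eps) (ve eps)) ->
    viscosity_subsolution T E ip A F q phi v) /\
  ((forall eps : R, 0 < eps ->
      viscosity_supersolution T E ip A (Fe eps) (qe eps) (phie eps) (ve eps)) ->
    viscosity_supersolution T E ip A F q phi v).
Proof.
have [ip_norm _] := hH; have T0 := ltW hT.
have [[sgE cE] _ _] := hyp.
have unif := uniform_close T0 hcvg.
have terminal y : Lambda_at T T y -> forall d : R, 0 < d ->
    exists2 eps : R, 0 < eps &
      `|ve eps y - v y| <= d / 2 /\ `|phie eps y - phi y| <= d / 2.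
  move=> Ly d d0; have [eps [eps0 h1 h2 _]] := unif (d / 2) (divr_gt0 d0 (ltr0n _ 2)).
  by exists eps => //; split; [apply: h1; case: Ly|exact: h2].
split=> visc; split=> //.
- move=> y Ly; apply/ler_addgt0Pr => d d0.
  have [eps eps0 [h1 h2]] := terminal y Ly d d0.
  have [_ /(_ y Ly) h3 _] := visc eps eps0.
  by move: h1 h2; rewrite !ler_norml => /andP[? ?] /andP[? ?]; lra.
- move=> t tT f ft fx Afx hf g a hg z zt z0 sup0.
  have Lz : Lambda T 0 z by case: zt.
  have zmax y : Lambda T t y -> v y - f y - g y <= v z - f z - g z.
    move=> Ly; have : ((v y - f y - g y)%:E <=
        ereal_sup [set (v y - f y - g y)%:E | y in Lambda T t])%E.
      by apply: ereal_sup_ubound; exists y.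
    by rewrite sup0 lee_fin z0.
  apply/sub_HamiltonianP => u; apply/ler_addgt0Pr => e e0.
  have e20 : 0 < e / 2 by rewrite divr_gt0.
  have [d1 /andP[d10 d1e] hclose] := Hamiltonian_close ip_norm
    (fx z + g_dx E ip a z) hyp Lz e20.
  have [d2 d20 htest] := perturbed_test T0 sgE cE ip_norm tT zt hf hg zmax d10.
  have [|eps [eps0 vv _ FF]] := unif (Num.min d1 d2); first by rewrite lt_min d10.
  have [||x [g' [a' [[xt xT ga'] [x0 xmax zx cc pp]]]]] := htest (ve eps).
  + exact: hve.
  + by move=> y /vv /le_trans; apply; rewrite ge_min lexx orbT.
  have Lx : Lambda T 0 x by case: xt.
  have [_ _ /(_ _ xT _ _ _ _ hf _ _ ga' x xt x0)] := visc eps eps0.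
  have -> : ereal_sup [set (ve eps y - f y - g' y)%:E | y in Lambda T (ptime x)] = 0%E.
    apply/eqP; rewrite eq_le; apply/andP; split.
      by apply: ge_ereal_sup => _ [y Ly <-]; rewrite lee_fin xmax.
    apply: ereal_sup_ubound; exists x; last by rewrite x0.
    exact: Lambda_at_Lambda.
  move=> /(_ erefl) /sub_HamiltonianP /(_ u) visu.
  have := hclose (Fe eps) (qe eps) x _ Lx zx pp.
  have FFx w : `|Fe eps x w - F x w| <= d1 /\ `|qe eps x w - q x w| <= d1.
    have [h1 h2] := FF x w Lx.
    by split; [apply: (le_trans h1)|apply: (le_trans h2)]; rewrite ge_min lexx.
  move=> /(_ FFx u).
  by move: cc; rewrite !ler_norml => /andP[? ?] /andP[? ?]; lra.
- move=> y Ly; apply/ler_addgt0Pr => d d0.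
  have [eps eps0 [h1 h2]] := terminal y Ly d d0.
  have [_ /(_ y Ly) h3 _] := visc eps eps0.
  by move: h1 h2; rewrite !ler_norml => /andP[? ?] /andP[? ?]; lra.
- move=> t tT f ft fx Afx hf g a hg z zt z0 inf0.
  have Lz : Lambda T 0 z by case: zt.
  have zmax y : Lambda T t y -> - v y - f y - g y <= - v z - f z - g z.
    move=> Ly; have : (ereal_inf [set (v y + f y + g y)%:E | y in Lambda T t] <=
        (v y + f y + g y)%:E)%E.
      by apply: ereal_inf_lbound; exists y.
    rewrite inf0 lee_fin; lra.
  have -> : - ft z - g_dt a z - ip (Afx z) (pend z) =
    - (ft z + g_dt a z + ip (Afx z) (pend z)) by ring.
  apply/super_HamiltonianP => e e0.
  have e30 : 0 < e / 3 by rewrite divr_gt0.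
  have [d1 /andP[d10 d1e] hclose] := Hamiltonian_close ip_norm
    (- fx z - g_dx E ip a z) hyp Lz e30.
  have [d2 d20 htest] := perturbed_test T0 sgE cE ip_norm tT zt hf hg zmax d10.
  have [|eps [eps0 vv _ FF]] := unif (Num.min d1 d2); first by rewrite lt_min d10.
  have [||x [g' [a' [[xt xT ga'] [x0 xmax zx cc pp]]]]] := htest (fun y => - ve eps y).
  + move=> y Ly r r0; have [r' r'0 h] := hve eps eps0 y Ly r r0.
    exists r' => // y' Ly' yy'; rewrite -opprD normrN; exact: h.
  + move=> y /vv h; rewrite -opprD normrN (le_trans h)// ge_min lexx orbT//.
  have Lx : Lambda T 0 x by case: xt.
  have x0' : ve eps x + f x + g' x = 0 by lra.
  have [_ _ /(_ _ xT _ _ _ _ hf _ _ ga' x xt x0')] := visc eps eps0.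
  have -> : ereal_inf [set (ve eps y + f y + g' y)%:E | y in Lambda T (ptime x)] = 0%E.
    apply/eqP; rewrite eq_le; apply/andP; split.
      apply: ereal_inf_lbound; exists x; last by rewrite x0'.
      exact: Lambda_at_Lambda.
    by apply: le_ereal_inf_tmp => _ [y Ly <-]; rewrite lee_fin; have := xmax y Ly; lra.
  move=> /(_ erefl) /super_HamiltonianP /(_ _ e30) [u visu]; exists u.
  have pp' : `|(- fx x - g_dx E ip a' x) - (- fx z - g_dx E ip a z)| <= d1.
    by rewrite -!opprD normrN.
  have := hclose (Fe eps) (qe eps) x _ Lx zx pp'.
  have FFx w : `|Fe eps x w - F x w| <= d1 /\ `|qe eps x w - q x w| <= d1.
    have [h1 h2] := FF x w Lx.
    by split; [apply: (le_trans h1)|apply: (le_trans h2)]; rewrite ge_min lexx.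
  move=> /(_ FFx u).
  by move: cc; rewrite !ler_norml => /andP[? ?] /andP[? ?]; lra.
Qed.
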